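(* Any simply connected 2-step nilpotent Lie group $(N,Q)$ endowed with a bi-invariant pseudo-Riemannian metric $Q$ is flat (and therefore has trivial holonomy).
   Context: Lie groups are real and finite dimensional. A pseudo-Riemannian metric on a Lie group is bi-invariant if all left and right translations are isometries. A Lie group is 2-step nilpotent if its Lie algebra $\mathfrak n$ satisfies $[\mathfrak n,[\mathfrak n,\mathfrak n]]=0$ and $[\mathfrak n,\mathfrak n]\neq0$. Flat means that the curvature tensor of the Levi-Civita connection of $Q$ vanishes identically. *)

(* Defs.v *)
From HB Require Import structures.
From mathcomp Require Import all_boot all_order all_algebra.
From mathcomp Require Import all_classical all_reals all_analysis.
Import Order.TTheory GRing.Theory Num.Theory.
Import numFieldNormedType.Exports.

Set Implicit Arguments.
Unset Strict Implicit.
Unset Printing Implicit Defensive.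

Local Open Scope classical_set_scope.
Local Open Scope ring_scope.

(* Model spaces E, F are normed modules over R : realType; manifolds are only
   ever modelled on 'rV[R]_n, R and finite products of these. *)

Section Smooth.
Context {R : realType}.
Implicit Types E F : normedModType R.

(* U is meant to be open.  For finite-dimensional E, continuity of every
   x |-> 'd f x v is continuity of the differential itself. *)
Fixpoint Ck (k : nat) E F (U : set E) (f : E -> F) : Prop :=
  match k with
  | 0%N => forall x, U x -> {for x, continuous f}
  | k'.+1 => (forall x, U x -> differentiable f x) /\
             (forall v, Ck k' U (fun x => 'd f x v))
  end.

Definition smooth_on E F (U : set E) (f : E -> F) := forall k, Ck k U f.

(* cmap restricts to a homeomorphism from cdom onto an open set of E, with
   inverse cinv; values outside are irrelevant. *)
Record chart (M : topologicalType) (E : normedModType R) := Chart {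
  cdom : set M;
  cmap : M -> E;
  cinv : E -> M }.

Record is_chart (M : topologicalType) E (a : chart M E) : Prop := {
  cdom_open : open (cdom a);
  cimage_open : open (cmap a @` cdom a);
  cmapK : forall p, cdom a p -> cinv a (cmap a p) = p;
  cmap_continuous : forall p, cdom a p -> {for p, continuous (cmap a)};
  cinv_continuous : forall p, cdom a p -> {for cmap a p, continuous (cinv a)} }.

(* An atlas, together with a preferred chart around each point. *)
Record charted (M : topologicalType) (E : normedModType R) := Charted {
  atlas : set (chart M E);
  chart_at : M -> chart M E }.

Record is_smooth_manifold (M : topologicalType) E (C : charted M E) : Prop := {
  mfd_hausdorff : hausdorff_space M;
  mfd_second_countable : @second_countable M;
  atlas_chart : forall a, atlas C a -> is_chart a;
  chart_at_atlas : forall p, atlas C (chart_at C p);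
  chart_at_dom : forall p, cdom (chart_at C p) p;
  transition_smooth : forall a b, atlas C a -> atlas C b ->
    smooth_on (cmap a @` (cdom a `&` cdom b)) (cmap b \o cinv a) }.

Definition model E : charted E E :=
  let a := Chart setT (@id E) (@id E) in Charted [set a] (fun=> a).

Definition prod_chart (M N : topologicalType) E F
    (a : chart M E) (b : chart N F) : chart (M * N)%type (E * F)%type :=
  Chart (cdom a `*` cdom b) (fun p => (cmap a p.1, cmap b p.2))
        (fun x => (cinv a x.1, cinv b x.2)).

Definition prod_charted (M N : topologicalType) E F
    (C : charted M E) (D : charted N F)
    : charted (M * N)%type (E * F)%type :=
  Charted [set prod_chart a b | a in atlas C & b in atlas D]
          (fun p => prod_chart (chart_at C p.1) (chart_at D p.2)).

Section Maps.
Context {M N : topologicalType} {E F : normedModType R}.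
Variables (C : charted M E) (D : charted N F).

Definition local_expr (f : M -> N) (p : M) : E -> F :=
  cmap (chart_at D (f p)) \o f \o cinv (chart_at C p).

(* Smooth in a neighbourhood of p. *)
Definition smooth_at (f : M -> N) (p : M) :=
  {for p, continuous f} /\
  exists2 W : set E, open_nbhs (cmap (chart_at C p) p) W &
                     smooth_on W (local_expr f p).

(* The tangent space of M at p is E: a tangent vector is given by its
   components in the preferred chart at p, the components in another chart
   being obtained with the Jacobian of the transition map (see [components]). *)
Definition tangent_map (f : M -> N) (p : M) : E -> F :=
  'd (local_expr f p) (cmap (chart_at C p) p).

End Maps.

Section Fields.
Context {M : topologicalType} {E : normedModType R}.
Variable C : charted M E.

Definition dirderiv (f : M -> R) (p : M) (v : E) : R :=
  tangent_map C (model R) f p v.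

Definition velocity (c : R -> M) (t : R) : E := tangent_map (model R) C c t 1.

Definition components (a : chart M E) (p : M) (v : E) : E :=
  tangent_map C (model E) (cmap a) p v.

(* A vector field is a function X : M -> E with X p in the tangent space of M
   at p, i.e. read in the preferred chart at p.  As this chart varies with p,
   X is not itself continuous in general: smoothness and differentiation of
   fields go through the components in a fixed chart. *)
Definition field_in_chart (a : chart M E) (X : M -> E) : E -> E :=
  fun x => components a (cinv a x) (X (cinv a x)).

Definition smooth_field_at (X : M -> E) (p : M) :=
  exists2 W : set E, open_nbhs (cmap (chart_at C p) p) W &
                     smooth_on W (field_in_chart (chart_at C p) X).

(* [X, Y] = XY - YX as derivations. *)
Definition lie_bracket (X Y : M -> E) (p : M) : E :=
  let a := chart_at C p in
  'd (field_in_chart a Y) (cmap a p) (X p)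
  - 'd (field_in_chart a X) (cmap a p) (Y p).

(* The field with constant components u in the chart a. *)
Definition coord_field (a : chart M E) (u : E) : M -> E :=
  fun q => tangent_map (model E) C (cinv a) (cmap a q) u.

Record pseudo_riemannian_metric (Q : M -> E -> E -> R) : Prop := {
  metric_sym : forall p u v, Q p u v = Q p v u;
  metric_linear : forall p u, scalar (Q p u);
  metric_nondegenerate : forall p u, (forall v, Q p u v = 0) -> u = 0;
  metric_smooth : forall X Y p, smooth_field_at X p -> smooth_field_at Y p ->
    smooth_at C (model R) (fun q => Q q (X q) (Y q)) p }.

(* nabla p v Y is the covariant derivative at p, in the direction v, of a field
   Y that is smooth near p; it only depends on the germ of Y at p, by the
   Leibniz rule applied to the indicator function of a neighbourhood of p. *)
Record affine_connection (nabla : M -> E -> (M -> E) -> E) : Prop := {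
  connection_linear : forall p Y, smooth_field_at Y p ->
    linear (fun v => nabla p v Y);
  connection_add : forall p v X Y,
    smooth_field_at X p -> smooth_field_at Y p ->
    nabla p v (fun q => X q + Y q) = nabla p v X + nabla p v Y;
  connection_leibniz : forall p v f Y,
    smooth_at C (model R) f p -> smooth_field_at Y p ->
    nabla p v (fun q => f q *: Y q)
    = dirderiv f p v *: Y p + f p *: nabla p v Y;
  connection_smooth : forall p X Y,
    smooth_field_at X p -> smooth_field_at Y p ->
    smooth_field_at (fun q => nabla q (X q) Y) p }.

Record levi_civita (Q : M -> E -> E -> R) (nabla : M -> E -> (M -> E) -> E)
    : Prop := {
  levi_civita_connection : affine_connection nabla;
  levi_civita_torsion_free : forall p X Y,
    smooth_field_at X p -> smooth_field_at Y p ->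
    nabla p (X p) Y - nabla p (Y p) X = lie_bracket X Y p;
  levi_civita_metric : forall p v X Y,
    smooth_field_at X p -> smooth_field_at Y p ->
    dirderiv (fun q => Q q (X q) (Y q)) p v
    = Q p (nabla p v X) (Y p) + Q p (X p) (nabla p v Y) }.

Definition curvature (nabla : M -> E -> (M -> E) -> E) (X Y Z : M -> E) (p : M)
    : E :=
  nabla p (X p) (fun q => nabla q (Y q) Z)
  - nabla p (Y p) (fun q => nabla q (X q) Z)
  - nabla p (lie_bracket X Y p) Z.

(* The Levi-Civita connection of Q exists and is unique (on fields smooth near
   the point), so the quantification over nabla ranges over one connection. *)
Definition flat (Q : M -> E -> E -> R) :=
  forall nabla, levi_civita Q nabla ->
  forall X Y Z p,
    smooth_field_at X p -> smooth_field_at Y p -> smooth_field_at Z p ->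
    curvature nabla X Y Z p = 0.

(* With a = chart_at C (c t), the field V along c is V^i d_i in the coordinates
   of a, and D_t V = (V^i)' d_i + V^i nabla_(c') d_i; at time t the second term
   is the derivative of the constant-coefficient field with value V t. *)
Definition covariant_derivative_along (nabla : M -> E -> (M -> E) -> E)
    (c : R -> M) (V : R -> E) (t : R) : E :=
  let a := chart_at C (c t) in
  'D_1 (fun s => components a (c s) (V s)) t
  + nabla (c t) (velocity c t) (coord_field a (V t)).

Definition parallel_at (nabla : M -> E -> (M -> E) -> E)
    (c : R -> M) (V : R -> E) (t : R) :=
  derivable (fun s => components (chart_at C (c t)) (c s) (V s)) t 1 /\
  covariant_derivative_along nabla c V t = 0.

(* P : T_p M -> T_q M is the parallel transport along some piecewise smooth
   path from p to q, a finite concatenation of paths [0, 1] -> M which are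
   smooth on a neighbourhood of [0, 1]. *)
Inductive parallel_transport (nabla : M -> E -> (M -> E) -> E)
    : M -> M -> (E -> E) -> Prop :=
| transport_smooth (c : R -> M) (P : E -> E) (e : R) :
    0 < e ->
    (forall t, - e < t < 1 + e -> smooth_at (model R) C c t) ->
    (forall v, exists V : R -> E, [/\ V 0 = v, V 1 = P v &
       forall t, - e < t < 1 + e -> parallel_at nabla c V t]) ->
    parallel_transport nabla (c 0) (c 1) P
| transport_concat (p q r : M) (P P' : E -> E) :
    parallel_transport nabla p q P -> parallel_transport nabla q r P' ->
    parallel_transport nabla p r (P' \o P).

Definition holonomy_group (nabla : M -> E -> (M -> E) -> E) (p : M)
    : set (E -> E) := parallel_transport nabla p p.

Definition trivial_holonomy (Q : M -> E -> E -> R) :=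
  forall nabla, levi_civita Q nabla ->
  forall p, holonomy_group nabla p = [set id].

End Fields.
End Smooth.

Definition simply_connected (R : realType) (T : topologicalType) :=
  (forall x y : T, exists c : R -> T,
     [/\ {within `[0, 1], continuous c}, c 0 = x & c 1 = y]) /\
  (forall c : R -> T, {within `[0, 1], continuous c} -> c 0 = c 1 ->
   exists H : R * R -> T,
     [/\ {within `[0, 1] `*` `[0, 1], continuous H},
         forall t, t \in `[0, 1] -> H (0, t) = c t,
         forall t, t \in `[0, 1] -> H (1, t) = c 0 &
         forall s, s \in `[0, 1] -> H (s, 0) = c 0 /\ H (s, 1) = c 0]).

(* No compatibility is required here; see [is_lie_group]. *)
#[short(type="groupTopologicalType")]
HB.structure Definition GroupTopological := {G of Topological G & Group G}.

Section LieGroup.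
Context {R : realType} {n : nat} {G : groupTopologicalType}.
Variable C : charted G 'rV[R]_n.

Record is_lie_group : Prop := {
  lie_group_manifold : is_smooth_manifold C;
  lie_group_mul_smooth : forall x : G * G,
    smooth_at (prod_charted C C) C (fun y : G * G => (y.1 * y.2)%g) x;
  lie_group_inv_smooth : forall x : G, smooth_at C C (fun y : G => (y^-1)%g) x }.

Definition left_translation (g : G) : G -> G := fun h => (g * h)%g.
Definition right_translation (g : G) : G -> G := fun h => (h * g)%g.

Definition left_invariant_field (u : 'rV[R]_n) : G -> 'rV[R]_n :=
  fun g => tangent_map C C (left_translation g) 1%g u.

(* The bracket of the Lie algebra, realized as the tangent space at 1. *)
Definition lie_algebra_bracket (u v : 'rV[R]_n) : 'rV[R]_n :=
  lie_bracket C (left_invariant_field u) (left_invariant_field v) 1%g.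

Definition two_step_nilpotent :=
  (forall u v w, lie_algebra_bracket u (lie_algebra_bracket v w) = 0) /\
  (exists u v, lie_algebra_bracket u v <> 0).

Definition bi_invariant (Q : G -> 'rV[R]_n -> 'rV[R]_n -> R) :=
  forall g h u v,
    Q (left_translation g h) (tangent_map C C (left_translation g) h u)
                             (tangent_map C C (left_translation g) h v) = Q h u v
 /\ Q (right_translation g h) (tangent_map C C (right_translation g) h u)
                              (tangent_map C C (right_translation g) h v) = Q h u v.

End LieGroup.

(* Main.v *)
(* Let L_u and R_u be the left and right invariant fields with value u at the
   unit.  They commute, and Q(L_u, L_v), Q(R_u, R_v) are constant; with torsion
   freeness this makes the trilinear form Q(nabla_(L_a) L_b, L_c) alternating,
   so nabla_(L_a) L_b = [L_a, L_b] / 2.  The function Q(R_u, L_c) has derivative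
   Q(R_u, L_[a,c]) along L_a, hence it is constant when c is a bracket, by
   2-step nilpotency.  It follows that the fields W_u = L_u + R_u are parallel;
   they span every tangent space because Q(W_u, W_v) = 4 Q_1(u, v) is constant.
   For parallel W and phi = Q(Z, W), Q(R(X, Y) Z, W) = XY phi - YX phi -
   [X, Y] phi = 0, and Q(V, W) is constant along a curve when V is parallel, so
   that both curvature and holonomy are trivial. *)
Require Import Defs.
From HB Require Import structures.
From mathcomp Require Import all_boot all_order all_algebra.
From mathcomp Require Import all_classical all_reals all_analysis.
From mathcomp Require Import ring.
Import Order.TTheory GRing.Theory Num.Theory.
Import numFieldNormedType.Exports.

Set Implicit Arguments.
Unset Strict Implicit.
Unset Printing Implicit Defensive.

Local Open Scope classical_set_scope.
Local Open Scope ring_scope.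

(** * Differentiability and C^k functions *)

(** The classical route computes the curvature on left invariant fields, where it is [- [[X, Y], Z]
    / 4]. Here [flat] quantifies over arbitrary fields smooth near a point, and holonomy over all
    piecewise smooth paths, so that route would also need tensoriality and a passage from curvature
    to transport. A global parallel frame settles both claims at once. The frame comes from
    exponential coordinates. At [g = exp x], 2-step nilpotency gives [R_u = L_(u - [x, u])], hence
    [nabla_(L_a) R_u = - L_[a, u] / 2], the opposite of [nabla_(L_a) L_u]. The proof avoids [exp]
    and reads this cancellation off the pairings with the fields [L_b]. The technical obstacle is
    that a tangent vector is recorded in the preferred chart at its own base point, which jumps from
    point to point: fields are moved to one fixed chart before they are differentiated. *)

Section DiffNear.
Context {R : realType}.
Implicit Types E F G : normedModType R.

Lemma near0_differentiable E F (h : E -> F) x :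
  (\forall y \near x, h y = 0) ->
  differentiable h x /\ forall v, 'd h x v = 0.
Proof.
move=> h0.
have h0' : \forall y \near 0, h (y + x) = 0.
  have := h0; rewrite (near_shift 0 x) /=; apply: filterS => y.
  by rewrite /= subr0.
have H : h \o shift x = cst (h x) + (\0 : E -> F) +o_ 0 id.
  apply/eqaddoP => _/posnumP[e]; rewrite (nbhs_singleton h0).
  near=> y; rewrite /= !fctE /= /cst !addr0 subr0.
  by rewrite (near h0' y) ?normr0 ?mulr_ge0//.
have c0 : continuous (\0 : E -> F) by exact: cst_continuous.
pose z : {linear E -> F} := \0.
have dh : 'd h x = z :> (E -> F) by apply: diff_unique.
by split; [apply/diff_locallyP; rewrite dh|move=> v; rewrite dh].
Unshelve. all: by end_near. Qed.

(** Locality of the differential: [g] is [f] plus a function that vanishes near [x], and only the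
    latter needs an estimate. *)
Lemma differentiable_near E F (f g : E -> F) x : {near x, f =1 g} ->
  differentiable f x -> differentiable g x /\ forall v, 'd g x v = 'd f x v.
Proof.
move=> fg df.
have gf0 : \forall y \near x, (g - f) y = 0.
  by apply: filterS fg => y fgy; rewrite !fctE fgy subrr.
have -> : g = f + (g - f) by rewrite addrC subrK.
move: (g - f : E -> F) (near0_differentiable gf0) => h [dh d0].
split=> [|v]; first exact: differentiableD.
have /(congr1 (fun k => k v)) -> := diffD df dh.
by rewrite -[LHS]/('d f x v + 'd h x v) d0 addr0.
Qed.

Lemma near_differentiable E F (f g : E -> F) x : {near x, f =1 g} ->
  differentiable f x -> differentiable g x.
Proof. by move=> fg df; have [] := differentiable_near fg df. Qed.

Lemma near_diff E F (f g : E -> F) x v : {near x, f =1 g} ->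
  differentiable f x -> 'd g x v = 'd f x v.
Proof. by move=> fg df; have [_] := differentiable_near fg df. Qed.

Lemma differentiable_scale E F (a : E -> R) (f : E -> F) x :
  differentiable a x -> differentiable f x ->
  differentiable (fun y => a y *: f y) x /\
  forall v, 'd (fun y => a y *: f y) x v = a x *: 'd f x v + 'd a x v *: f x.
Proof.
move=> da df.
(* Packing scalar multiplication as a bilinear map turns the product rule into the chain rule for
   [y |-> (a y, f y)]. *)
have scale_bilin : bilinear_for (GRing.Scale.Law.clone _ _ *:%R _)
    (GRing.Scale.Law.clone _ _ *:%R _) (@GRing.scale R F).
  split=> [u'|u] c y z /=; first by rewrite scalerDl scalerA.
  by rewrite scalerDr !scalerA mulrC.
pose bM := bilinear_isBilinear.Build R R F F _ _ _ scale_bilin.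
pose B : {bilinear R -> F -> F} := HB.pack (@GRing.scale R F) bM.
have Bc : continuous (fun p : R * F => B p.1 p.2) by exact: scale_continuous.
have dp := differentiable_bilin (f := B) (a x, f x) Bc.
have Dp := diff_bilin (f := B) (a x, f x) Bc.
have dq := differentiable_pair da df.
have Dq := diff_pair da df.
split; first exact: (differentiable_comp dq dp).
move=> v.
by have /(congr1 (fun k => k v)) -> := diff_comp dq dp; rewrite /comp Dq Dp.
Qed.

Lemma differentiable_compose E F G (f : E -> F) (g : F -> G) x :
  differentiable f x -> differentiable g (f x) ->
  differentiable (fun y => g (f y)) x /\
  forall v, 'd (fun y => g (f y)) x v = 'd g (f x) ('d f x v).
Proof.
move=> df dg; split; first exact: (differentiable_comp df dg).
by move=> v; have /(congr1 (fun k => k v)) := diff_comp df dg.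
Qed.

Lemma differentiable_add E F (f g : E -> F) x :
  differentiable f x -> differentiable g x ->
  differentiable (fun y => f y + g y) x /\
  forall v, 'd (fun y => f y + g y) x v = 'd f x v + 'd g x v.
Proof.
move=> df dg; split; first exact: (differentiableD df dg).
by move=> v; have /(congr1 (fun k => k v)) := diffD df dg.
Qed.

Lemma differentiable_sub E F (f g : E -> F) x :
  differentiable f x -> differentiable g x ->
  differentiable (fun y => f y - g y) x /\
  forall v, 'd (fun y => f y - g y) x v = 'd f x v - 'd g x v.
Proof.
move=> df dg; split; first exact: (differentiableB df dg).
by move=> v; have /(congr1 (fun k => k v)) := diffB df dg.
Qed.

Lemma differentiable_prod E F G (f : E -> F) (g : E -> G) x :
  differentiable f x -> differentiable g x ->
  differentiable (fun y => (f y, g y)) x /\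
  forall v, 'd (fun y => (f y, g y)) x v = ('d f x v, 'd g x v).
Proof.
move=> df dg; split; first exact: (differentiable_pair df dg).
by move=> v; have /(congr1 (fun k => k v)) := diff_pair df dg.
Qed.

Lemma differentiable_linear E F (f : E -> F) x : linear f -> continuous f ->
  differentiable f x /\ forall v, 'd f x v = f v.
Proof.
move=> lf cf.
pose l : {linear E -> F} := HB.pack f (GRing.isLinear.Build _ _ _ _ f lf).
split; first exact: (@linear_differentiable _ _ _ l).
by move=> v; have /(congr1 (fun k => k v)) := @diff_lin _ _ _ l x cf.
Qed.

Lemma differentiable_const E F (a : F) (x : E) :
  differentiable (fun=> a) x /\ forall v, 'd (fun _ : E => a) x v = 0.
Proof.
split; first exact: differentiable_cst.
by move=> v; have /(congr1 (fun k => k v)) := @diff_cst _ E F a x.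
Qed.

Lemma differentiable_id E (x : E) :
  differentiable (fun y => y) x /\ forall v, 'd (fun y : E => y) x v = v.
Proof. by apply: differentiable_linear => // y; exact: cvg_id. Qed.
End DiffNear.

Section CkCalculus.
Context {R : realType}.
Implicit Types E F G : normedModType R.

(** [Ck] controls [x |-> 'd f x v] for a fixed direction [v] only. The coordinates [c i] split a
    direction that varies with the point into fixed ones. *)
Definition finite_dim F := exists m (e : 'I_m -> F) (c : 'I_m -> F -> R),
  (forall i, linear (c i) /\ continuous (c i)) /\
  forall x, x = \sum_i c i x *: e i.

Lemma Ck_ext k E F (U : set E) (f g : E -> F) : open U ->
  {in U, f =1 g} -> Ck k U f -> Ck k U g.
Proof.
move=> oU; elim: k f g => [|k IH] f g fg.
  move=> cf x Ux; have := cf x Ux; rewrite /prop_for /continuous_at fg ?inE//.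
  apply: cvg_trans; apply: near_eq_cvg.
  by apply: filterS (open_nbhs_nbhs (conj oU Ux)) => y Uy; rewrite fg ?inE.
have nfg x : U x -> {near x, f =1 g}.
  by move=> Ux; apply: filterS (open_nbhs_nbhs (conj oU Ux)) => y Uy; rewrite fg ?inE.
move=> [df ddf]; split=> [x Ux|v].
  exact: near_differentiable (nfg x Ux) (df x Ux).
apply: IH (ddf v) => x /[!inE] Ux.
exact: esym (near_diff v (nfg x Ux) (df x Ux)).
Qed.

Lemma CkS k E F (U : set E) (f : E -> F) : Ck k.+1 U f -> Ck k U f.
Proof.
elim: k f => [|k IH] f [df ddf].
  by move=> x Ux; exact: differentiable_continuous (df x Ux).
by split=> // v; apply: IH.
Qed.

Lemma Ck_sub k E F (U V : set E) (f : E -> F) : V `<=` U -> Ck k U f -> Ck k V f.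
Proof.
move=> VU; elim: k f => [|k IH] f; first by move=> cf x Vx; exact: (cf x (VU x Vx)).
by move=> [df ddf]; split=> [x Vx|v]; [exact: (df x (VU x Vx))|exact: (IH _ (ddf v))].
Qed.

Lemma Ck_const k E F (U : set E) (a : F) : open U -> Ck k U (fun=> a).
Proof.
move=> oU; elim: k a => [|k IH] a; first by move=> x _; apply: cst_continuous.
split=> [x _|v]; first by have [] := differentiable_const a x.
apply: (@Ck_ext _ _ _ _ (fun=> 0)) => // x _.
by have [_ ->] := differentiable_const a x.
Qed.

Lemma Ck_linear_comp k E F G (U : set E) (f : E -> F) (l : F -> G) :
  open U -> linear l -> continuous l -> Ck k U f -> Ck k U (fun x => l (f x)).
Proof.
move=> oU ll cl; elim: k f => [|k IH] f.
  by move=> cf x Ux; apply: continuous_comp; [exact: cf|exact: cl].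
move=> [df ddf].
have dl x : U x -> _ := fun Ux =>
  differentiable_compose (df x Ux) (differentiable_linear (f x) ll cl).1.
split=> [x /dl[]//|v].
apply: Ck_ext (IH _ (ddf v)) => // x; rewrite inE => Ux.
by have [_ ->] := dl x Ux; have [_ ->] := differentiable_linear (f x) ll cl.
Qed.

Lemma Ck_linear k E F (U : set E) (l : E -> F) :
  open U -> linear l -> continuous l -> Ck k U l.
Proof.
move=> oU ll cl; case: k => [|k]; first by move=> x _; exact: cl.
split=> [x _|v]; first by have [] := differentiable_linear x ll cl.
apply: Ck_ext (Ck_const k (l v) oU) => // x _.
by have [_ ->] := differentiable_linear x ll cl.
Qed.

Lemma Ck_add k E F (U : set E) (f g : E -> F) : open U ->
  Ck k U f -> Ck k U g -> Ck k U (fun x => f x + g x).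
Proof.
move=> oU; elim: k f g => [|k IH] f g.
  by move=> cf cg x Ux; apply: continuousD; [exact: cf|exact: cg].
move=> [df ddf] [dg ddg].
have d x : U x -> _ := fun Ux => differentiable_add (df x Ux) (dg x Ux).
split=> [x /d[]//|v].
apply: Ck_ext (IH _ _ (ddf v) (ddg v)) => // x; rewrite inE => Ux; exact: esym ((d x Ux).2 v).
Qed.

Lemma Ck_sum k E F (U : set E) m (f : 'I_m -> E -> F) : open U ->
  (forall i, Ck k U (f i)) -> Ck k U (fun x => \sum_i f i x).
Proof.
move=> oU Cf; elim: m f Cf => [|m IH] f Cf.
  by apply: Ck_ext (Ck_const k 0 oU) => // x _; rewrite big_ord0.
apply: Ck_ext (Ck_add oU (Cf ord0) (IH (fun i => f (lift ord0 i)) _)) => // x _.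
by rewrite big_ord_recl.
Qed.

Lemma Ck_scale k E F (U : set E) (a : E -> R) (f : E -> F) : open U ->
  Ck k U a -> Ck k U f -> Ck k U (fun x => a x *: f x).
Proof.
move=> oU; elim: k a f => [|k IH] a f.
  move=> ca cf x Ux; apply: (@cvgZ _ _ _ _ _ a f (a x) (f x)).
    exact: ca.
  exact: cf.
move=> Ca Cf; have [[da dda] [df ddf]] := (Ca, Cf).
have d x : U x -> _ := fun Ux => differentiable_scale (da x Ux) (df x Ux).
split=> [x /d[]//|v].
apply: Ck_ext (Ck_add oU (IH _ _ (CkS Ca) (ddf v)) (IH _ _ (dda v) (CkS Cf))) => //.
by move=> x; rewrite inE => Ux; exact: esym ((d x Ux).2 v).
Qed.

Lemma Ck_pair k E F G (U : set E) (f : E -> F) (g : E -> G) : open U ->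
  Ck k U f -> Ck k U g -> Ck k U (fun x => (f x, g x)).
Proof.
move=> oU; elim: k f g => [|k IH] f g.
  by move=> cf cg x Ux; apply: cvg_pair; [exact: cf|exact: cg].
move=> [df ddf] [dg ddg].
have d x : U x -> _ := fun Ux => differentiable_prod (df x Ux) (dg x Ux).
split=> [x /d[]//|v].
apply: Ck_ext (IH _ _ (ddf v) (ddg v)) => // x; rewrite inE => Ux; exact: esym ((d x Ux).2 v).
Qed.


Lemma diff_sum_basis E F (f : E -> F) x m (e : 'I_m -> E) (c : 'I_m -> R) :
  'd f x (\sum_i c i *: e i) = \sum_i c i *: 'd f x (e i).
Proof. by rewrite linear_sum; apply: eq_bigr => i _; rewrite linearZ. Qed.

(** In ['d g (f x) ('d f x v)] both the point and the direction vary with [x]. Expanding the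
    direction over the [e i] leaves fixed directions, with coefficients [c i ('d f x v)] of class
    C^k, so the induction closes. *)
Lemma Ck_comp k E F G (U : set E) (V : set F) (f : E -> F) (g : F -> G) :
  finite_dim F -> open U -> open V -> (forall x, U x -> V (f x)) ->
  Ck k U f -> Ck k V g -> Ck k U (fun x => g (f x)).
Proof.
move=> [m [e [c [cl ce]]]] oU oV UV; elim: k g => [|k IH] g.
  by move=> cf cg x Ux; apply: continuous_comp; [exact: cf|exact/cg/UV].
move=> Cf [dg ddg]; have [df ddf] := Cf.
have d x : U x -> _ := fun Ux =>
  differentiable_compose (df x Ux) (dg _ (UV x Ux)).
split=> [x /d[]//|v].
have H i : Ck k U (fun x => c i ('d f x v) *: 'd g (f x) (e i)).
  apply: Ck_scale => //; last exact: (IH _ (CkS Cf) (ddg (e i))).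
  by have [lc cc] := cl i; exact: (Ck_linear_comp oU lc cc (ddf v)).
apply: Ck_ext (Ck_sum oU H) => // x; rewrite inE => Ux.
by have [_ ->] := d x Ux; rewrite [in RHS](ce ('d f x v)) diff_sum_basis.
Qed.

Lemma Ck_diff_field k E F (U : set E) (f : E -> F) (Y : E -> E) :
  finite_dim E -> open U -> Ck k.+1 U f -> Ck k U Y ->
  Ck k U (fun x => 'd f x (Y x)).
Proof.
move=> [m [e [c [cl ce]]]] oU [df ddf] CY.
have H i : Ck k U (fun x => c i (Y x) *: 'd f x (e i)).
  apply: Ck_scale => //; last exact: ddf.
  by have [lc cc] := cl i; exact: (Ck_linear_comp oU lc cc CY).
apply: Ck_ext (Ck_sum oU H) => // x; rewrite inE => Ux.
by rewrite [in RHS](ce (Y x)) diff_sum_basis.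
Qed.
End CkCalculus.

Section FiniteDim.
Context {R : realType}.

Lemma finite_dim_rV n : finite_dim 'rV[R]_n.
Proof.
exists n, (fun i => delta_mx 0 i), (fun i (x : 'rV[R]_n) => x 0 i); split=> [i|x].
  split; last exact: coord_continuous.
  by move=> a x y; rewrite !mxE.
exact: row_sum_delta.
Qed.

Lemma finite_dim_prod (E F : normedModType R) :
  finite_dim E -> finite_dim F -> finite_dim (E * F)%type.
Proof.
move=> [m [e [c [cl ce]]]] [m' [e' [c' [cl' ce']]]].
exists (m + m')%N, (fun i : 'I_(m + m') => match fintype.split i with
  | inl j => (e j, 0) | inr j => (0, e' j) end),
  (fun (i : 'I_(m + m')) (x : E * F) => match fintype.split i with
  | inl j => c j x.1 | inr j => c' j x.2 end); split=> [i|x].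
  case: (fintype.split i) => j.
    have [l k] := cl j; split; first by move=> a x y; exact: l.
    by move=> x; apply: (@continuous_comp _ _ _ fst (c j)); [exact: cvg_fst|exact: k].
  have [l k] := cl' j; split; first by move=> a x y; exact: l.
  by move=> x; apply: (@continuous_comp _ _ _ snd (c' j)); [exact: cvg_snd|exact: k].
rewrite big_split_ord /=.
under eq_bigr => i _ do rewrite -[lshift _ _]/(unsplit (inl i)) unsplitK.
under [X in _ + X]eq_bigr => i _ do
  rewrite -[rshift _ _]/(unsplit (inr i)) unsplitK.
have H (p : E * F) : p = (p.1, 0) + (0, p.2).
  have -> : (p.1, 0) + (0, p.2) = (p.1 + 0, 0 + p.2) :> E * F by [].
  by rewrite addr0 add0r; case: p.
have inl_lin k (a b : E) : (k *: a + b, 0) = k *: (a, 0) + (b, 0) :> E * F.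
  have -> : k *: (a, 0) + (b, 0) = (k *: a + b, k *: 0 + 0) :> E * F by [].
  by rewrite scaler0 addr0.
have inr_lin k (a b : F) : (0, k *: a + b) = k *: (0, a) + (0, b) :> E * F.
  have -> : k *: (0, a) + (0, b) = (k *: 0 + 0, k *: a + b) :> E * F by [].
  by rewrite scaler0 addr0.
rewrite [LHS]H; congr (_ + _).
  rewrite [in LHS](ce x.1); elim/big_rec2: _ => // i y1 y2 _ <-.
  exact: inl_lin.
rewrite [in LHS](ce' x.2); elim/big_rec2: _ => // i y1 y2 _ <-.
exact: inr_lin.
Qed.
End FiniteDim.

(** * Mean value theorem and mixed second derivatives of real functions *)

Section MeanValue.
Context {R : realType} {E : normedModType R}.

Lemma is_derive_line (F : normedModType R) (f : E -> F) (a u : E) (t : R) :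
  differentiable f (a + t *: u) ->
  is_derive t (1 : R) (fun s => f (a + s *: u)) ('d f (a + t *: u) u).
Proof.
move=> df.
have [dl el] : differentiable (fun s : R => a + s *: u) t /\
    forall h, 'd (fun s : R => a + s *: u) t h = h *: u.
  have [d1 e1] := differentiable_const a t.
  have l : linear (fun s : R => s *: u).
    by move=> k y z; rewrite scalerDl scalerA.
  have [d2 e2] := differentiable_linear t l (@scalel_continuous _ _ u).
  have [d3 e3] := differentiable_add d1 d2.
  split; [exact: d3|move=> h; apply: etrans (e3 h) _].
  by apply: etrans (congr2 +%R (e1 h) (e2 h)) _; rewrite add0r.
have [d e] := differentiable_compose dl df.
apply: DeriveDef; first exact: diff_derivable.
rewrite deriveE //; apply: etrans (e _) _; congr ('d f _ _).
by rewrite el scale1r.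
Qed.

Lemma mean_value_line (f : E -> R) (a u : E) (s : R) : 0 <= s ->
  (forall t, 0 <= t <= s -> differentiable f (a + t *: u)) ->
  exists2 t, 0 <= t <= s & f (a + s *: u) - f a = s * 'd f (a + t *: u) u.
Proof.
move=> s0 df.
have D t : 0 <= t <= s -> _ := fun ts => is_derive_line (df t ts).
have H : exists2 t, t \in `[0, s]%R &
    f (a + s *: u) - f (a + 0 *: u) = 'd f (a + t *: u) u * (s - 0).
  apply: (MVT_segment (f := fun t => f (a + t *: u))) => //.
    by move=> t; rewrite in_itv /= => /andP[/ltW t0 /ltW ts]; apply: D; rewrite t0.
  apply: derivable_within_continuous => t; rewrite in_itv /= => ts.
  by have [] := D t ts.
have [t] := H; rewrite in_itv /= => ts e; exists t => //.
by move: e; rewrite scale0r addr0 subr0 mulrC.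
Qed.

(** The second difference over a parallelogram: the mean value theorem is applied along [u] to
    [y |-> f (y + s *: v) - f y], then along [v] to [y |-> 'd f y u]. What matters later is that the
    left side is symmetric in [u] and [v]. *)
Lemma mean_value_square (U : set E) (f : E -> R) (x u v : E) (s : R) : 0 <= s ->
  Ck 2 U f ->
  (forall a b, 0 <= a <= s -> 0 <= b <= s -> U (x + a *: u + b *: v)) ->
  exists a b, [/\ 0 <= a <= s, 0 <= b <= s &
    f (x + s *: u + s *: v) - f (x + s *: u) - (f (x + s *: v) - f x)
    = s * s * 'd (fun y => 'd f y u) (x + a *: u + b *: v) v].
Proof.
move=> s0 [df ddf] H.
have ss : 0 <= s <= s by rewrite s0 lexx.
have z0 : 0 <= (0 : R) <= s by rewrite lexx.
pose g y := f (y + s *: v) - f y.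
have dg t : 0 <= t <= s -> differentiable g (x + t *: u) /\
    'd g (x + t *: u) u = 'd f (x + t *: u + s *: v) u - 'd f (x + t *: u) u.
  move=> ts.
  have [d1 e1] := differentiable_id (x + t *: u).
  have [d2 e2] := differentiable_const (s *: v) (x + t *: u).
  have [d3 e3] := differentiable_add d1 d2.
  have [d4 e4] := differentiable_compose d3 (df _ (H _ _ ts ss)).
  have d5 : differentiable f (x + t *: u).
    by have := df _ (H _ _ ts z0); rewrite scale0r addr0.
  have [d6 e6] := differentiable_sub d4 d5.
  split; [exact: d6|apply: etrans (e6 u) _]; congr (_ - _).
  apply: etrans (e4 u) _; congr ('d f _ _); apply: etrans (e3 u) _.
  by apply: etrans (congr2 +%R (e1 u) (e2 u)) _; rewrite addr0.
have [a as_ ea] := mean_value_line s0 (fun t ts => (dg t ts).1).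
have [b bs eb] := @mean_value_line (fun y => 'd f y u) (x + a *: u) v s s0
  (fun t ts => (ddf u).1 _ (H a t as_ ts)).
exists a, b; split=> //.
by move: ea; rewrite /g => ->; rewrite (dg a as_).2 eb mulrA.
Qed.

Lemma const_of_diff0 (f : E -> R) x (r : R) :
  (forall y, ball x r y -> differentiable f y /\ forall v, 'd f y v = 0) ->
  forall y, ball x r y -> f y = f x.
Proof.
move=> H y yr.
have B t : 0 <= t <= 1 -> ball x r (x + t *: (y - x)).
  move=> /andP[t0 t1]; move: yr; rewrite -!ball_normE /= opprD addNKr normrN.
  rewrite normrZ ger0_norm // distrC => yr.
  by rewrite (le_lt_trans _ yr)// ler_piMl.
have [t ts] := mean_value_line (f := f) ler01 (fun t ts => (H _ (B t ts)).1).
rewrite scale1r [x + (y - x)]addrC subrK (H _ (B t ts)).2 mulr0.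
by move/eqP; rewrite subr_eq0 => /eqP.
Qed.

(** One second difference is [s * s] times either mixed derivative, taken at two points near [x].
    Continuity of both mixed derivatives at [x] then bounds their difference there by any
    [e > 0]. *)
Lemma schwarz_real (U : set E) (f : E -> R) (x u v : E) :
  open U -> U x -> Ck 2 U f ->
  'd (fun y => 'd f y u) x v = 'd (fun y => 'd f y v) x u.
Proof.
move=> oU Ux C2; have [_ ddf] := C2.
pose P w z y := 'd (fun y => 'd f y w) y z.
rewrite -[LHS]/(P u v x) -[RHS]/(P v u x).
have cP w z : {for x, continuous (P w z)} by have [_ /(_ z)] := ddf w; exact.
apply/eqP; rewrite -subr_eq0 -normr_le0; apply/ler_addgt0Pr => e e0.
rewrite add0r.
have e2 : 0 < e / 2 by rewrite divr_gt0.
have N : \forall y \near x, [/\ U y, `|P u v x - P u v y| < e / 2 &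
    `|P v u x - P v u y| < e / 2].
  near=> y; split; near: y; first exact: open_nbhs_nbhs.
    by have /cvgr_dist_lt/(_ _ e2) := cP u v; apply.
  by have /cvgr_dist_lt/(_ _ e2) := cP v u; apply.
have /nbhs_ballP[r /= r0 Br] := N.
(* A side short enough for the whole parallelogram to lie in the ball; the [+ 1] makes the
   denominator positive and the inequality strict. *)
pose s := r / (`|u| + `|v| + 1).
have k0 : 0 < `|u| + `|v| + 1 by rewrite ltr_wpDl // addr_ge0.
have s0 : 0 < s by rewrite divr_gt0.
have sb a b (w z : E) : `|w| + `|z| = `|u| + `|v| ->
    0 <= a <= s -> 0 <= b <= s -> ball x r (x + a *: w + b *: z).
  move=> wz /andP[a0 as_] /andP[b0 bs].
  rewrite -ball_normE /= -addrA opprD addNKr normrN.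
  apply: le_lt_trans (ler_normD _ _) _; rewrite !normrZ !ger0_norm //.
  apply: (@le_lt_trans _ _ (s * (`|w| + `|z|))).
    by rewrite mulrDr lerD // ler_wpM2r.
  by rewrite wz /s -mulrA gtr_pMr // ltr_pdivrMl // mulr1 ltrDl.
have C2' : Ck 2 (ball x r) f by apply: Ck_sub C2 => y /Br[].
have [a [b [as_ bs eab]]] := mean_value_square (ltW s0) C2'
  (fun a b => sb a b u v erefl).
have [c [d [cs ds ecd]]] := mean_value_square (ltW s0) C2'
  (fun a b => sb a b v u (addrC _ _)).
have ss0 : s * s != 0 by rewrite mulf_neq0 // gt_eqF.
have E1 : P u v (x + a *: u + b *: v) = P v u (x + c *: v + d *: u).
  apply: (mulfI ss0); rewrite -[LHS]eab -[RHS]ecd [x + s *: v + _]addrAC.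
  by rewrite !opprB !addrA; ring.
have [_ n1 _] := Br _ (sb a b u v erefl as_ bs).
have [_ _ n2] := Br _ (sb c d v u (addrC _ _) cs ds).
rewrite -E1 in n2.
rewrite (splitr e).
have -> : P u v x - P v u x = P u v x - P u v (x + a *: u + b *: v)
   - (P v u x - P u v (x + a *: u + b *: v)) by rewrite opprB addrA subrK.
apply: le_trans (ler_normB _ _) _.
by rewrite lerD // ltW.
Unshelve. all: by end_near. Qed.
End MeanValue.

(** * Symmetry of second derivatives *)

Section SecondDerivatives.
Context {R : realType}.
Implicit Types E F : normedModType R.

Lemma differentiable_bigsum E F m (f : 'I_m -> E -> F) x :
  (forall i, differentiable (f i) x) ->
  differentiable (fun y => \sum_i f i y) x /\
  forall v, 'd (fun y => \sum_i f i y) x v = \sum_i 'd (f i) x v.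
Proof.
elim: m f => [|m IH] f df.
  have -> : (fun y => \sum_(i < 0) f i y) = (fun=> 0).
    by apply/funext => y; rewrite big_ord0.
  have [d e] := differentiable_const (0 : F) x.
  by split=> [|v]; [exact: d|rewrite big_ord0; exact: e].
have -> : (fun y => \sum_(i < m.+1) f i y) =
    (fun y => f ord0 y + \sum_(i < m) f (lift ord0 i) y).
  by apply/funext => y; rewrite big_ord_recl.
have [d1 e1] := IH _ (fun i => df (lift ord0 i)).
have [d2 e2] := differentiable_add (df ord0) d1.
split=> [|v]; first exact: d2.
by rewrite big_ord_recl; apply: etrans (e2 v) _; congr (_ + _); exact: e1.
Qed.

(** Each linear coordinate [c i] commutes with both differentiations, which reduces the claim to
    real functions. *)
Lemma schwarz E F (U : set E) (f : E -> F) (x u v : E) : finite_dim F ->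
  open U -> U x -> Ck 2 U f ->
  'd (fun y => 'd f y u) x v = 'd (fun y => 'd f y v) x u.
Proof.
move=> [m [e [c [cl ce]]]] oU Ux C2; have [df ddf] := C2.
have cE (a b : E) i : c i ('d (fun y => 'd f y a) x b) =
    'd (fun y => 'd (fun z => c i (f z)) y a) x b.
  have [lc cc] := cl i.
  have d1 : differentiable (fun y => 'd f y a) x := (ddf a).1 x Ux.
  have d2 := differentiable_linear ('d f x a) lc cc.
  have [d3 e3] := differentiable_compose d1 d2.1.
  rewrite -d2.2; apply: etrans (esym (e3 b)) _; apply: esym.
  apply: near_diff d3; apply: filterS (open_nbhs_nbhs (conj oU Ux)) => y Uy.
  have d4 := differentiable_linear (f y) lc cc.
  have [_ e4] := differentiable_compose (df y Uy) d4.1.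
  by apply: esym; apply: etrans (e4 a) _; exact: d4.2.
rewrite [LHS]ce [RHS]ce; apply: eq_bigr => i _; congr (_ *: _).
have [lc cc] := cl i.
rewrite !cE; exact: (schwarz_real _ _ oU Ux (Ck_linear_comp oU lc cc C2)).
Qed.

(* The value [Y x] is frozen in the second-derivative term. *)
Lemma differentiable_diff_field E F (U : set E) (f : E -> F) (Y : E -> E) x :
  finite_dim E -> open U -> U x -> Ck 2 U f -> differentiable Y x ->
  differentiable (fun y => 'd f y (Y y)) x /\
  forall v, 'd (fun y => 'd f y (Y y)) x v =
    'd (fun y => 'd f y (Y x)) x v + 'd f x ('d Y x v).
Proof.
move=> [m [e [c [cl ce]]]] oU Ux [df ddf] dY.
have H (Z : E -> E) : differentiable Z x ->
    differentiable (fun y => 'd f y (Z y)) x /\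
    forall v, 'd (fun y => 'd f y (Z y)) x v =
      \sum_i c i (Z x) *: 'd (fun y => 'd f y (e i)) x v + 'd f x ('d Z x v).
  move=> dZ.
  have -> : (fun y => 'd f y (Z y)) = fun y => \sum_i c i (Z y) *: 'd f y (e i).
    by apply/funext => y; rewrite [in LHS](ce (Z y)) diff_sum_basis.
  have d1 i := differentiable_linear (Z x) (cl i).1 (cl i).2.
  have d2 i := differentiable_compose dZ (d1 i).1.
  have d3 i := differentiable_scale (d2 i).1 ((ddf (e i)).1 x Ux).
  have [d4 e4] := differentiable_bigsum (fun i => (d3 i).1).
  split=> [|v]; first exact: d4.
  apply: etrans (e4 v) _.
  rewrite [in RHS](ce ('d Z x v)) diff_sum_basis -big_split /=.
  apply: eq_bigr => i _; apply: etrans ((d3 i).2 v) _; congr (_ + _ *: _).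
  by apply: etrans ((d2 i).2 v) _; exact: (d1 i).2.
have [d1 e1] := H Y dY; have [d0 e0] := differentiable_const (Y x) x.
have [_ e2] := H _ d0.
split=> [|v]; first exact: d1.
apply: etrans (e1 v) _; congr (_ + _); apply: esym; apply: etrans (e2 v) _.
by rewrite (e0 v) linear0 addr0.
Qed.

(** The second-derivative terms cancel by [schwarz] and only the derivatives of the fields survive:
    this is [X (Y f) - Y (X f) = [X, Y] f] in a vector space. *)
Lemma diff_field_antisym E F (U : set E) (f : E -> F) (X Y : E -> E) x :
  finite_dim E -> finite_dim F -> open U -> U x -> Ck 2 U f ->
  differentiable X x -> differentiable Y x ->
  'd (fun y => 'd f y (Y y)) x (X x) - 'd (fun y => 'd f y (X y)) x (Y x) =
  'd f x ('d Y x (X x) - 'd X x (Y x)).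
Proof.
move=> fE fF oU Ux C2 dX dY.
have [_ eX] := differentiable_diff_field fE oU Ux C2 dX.
have [_ eY] := differentiable_diff_field fE oU Ux C2 dY.
have S := schwarz (X x) (Y x) fF oU Ux C2.
have K (a a' b c d : F) : a' = a -> d = b - c -> a + b - (a' + c) = d.
  by move=> -> ->; rewrite opprD addrACA subrr add0r.
apply: etrans (congr2 (fun a b => a - b) (eY (X x)) (eX (Y x))) _.
by apply: K; [exact: S|exact: linearB].
Qed.

(** Differentiating the two relations by the chain rule yields the terms of [diff_field_antisym].
    Relatedness, rather than push-forward, suits the group multiplication, which is not
    injective. *)
Lemma bracket_related E F (U : set E) (f : E -> F) (X Y : E -> E)
    (X' Y' : F -> F) x :
  finite_dim E -> finite_dim F -> open U -> U x -> Ck 2 U f ->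
  differentiable X x -> differentiable Y x ->
  differentiable X' (f x) -> differentiable Y' (f x) ->
  {near x, (fun y => X' (f y)) =1 fun y => 'd f y (X y)} ->
  {near x, (fun y => Y' (f y)) =1 fun y => 'd f y (Y y)} ->
  'd Y' (f x) (X' (f x)) - 'd X' (f x) (Y' (f x)) =
  'd f x ('d Y x (X x) - 'd X x (Y x)).
Proof.
move=> fE fF oU Ux C2 dX dY dX' dY' nX nY.
have df : differentiable f x by have [df _] := C2; exact: df.
have [d1 e1] := differentiable_compose df dX'.
have [d2 e2] := differentiable_compose df dY'.
rewrite -(diff_field_antisym fE fF oU Ux C2 dX dY); congr (_ - _).
  by rewrite (nbhs_singleton nX) -e2; apply: esym; exact: near_diff.
by rewrite (nbhs_singleton nY) -e1; apply: esym; exact: near_diff.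
Qed.
End SecondDerivatives.

(** * Charts and tangent maps *)

Section Charts.
Context {R : realType}.

Section OneChart.
Context {M : topologicalType} {E : normedModType R}.
Variables (a : chart M E) (chart_a : is_chart a).

Lemma near_cmapK p : cdom a p -> \forall q \near p, cinv a (cmap a q) = q.
Proof.
move=> ap; apply: filterS (open_nbhs_nbhs (conj (cdom_open chart_a) ap)).
exact: cmapK chart_a.
Qed.

Lemma near_cinv p (P : set M) : cdom a p -> (\forall q \near p, P q) ->
  \forall x \near cmap a p, P (cinv a x).
Proof.
move=> ap nP; have := cinv_continuous chart_a ap.
by rewrite /prop_for /continuous_at (cmapK chart_a ap) => /(_ _ nP).
Qed.

Lemma near_cinvK p : cdom a p ->
  \forall x \near cmap a p, cdom a (cinv a x) /\ cmap a (cinv a x) = x.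
Proof.
move=> ap.
have : nbhs (cmap a p) (cmap a @` cdom a).
  by apply: open_nbhs_nbhs; split; [exact: cimage_open chart_a|exists p].
by apply: filterS => _ [q aq <-]; rewrite (cmapK chart_a aq).
Qed.

Lemma cmap_image_open (U : set M) : open U -> open (cmap a @` (cdom a `&` U)).
Proof.
move=> oU; rewrite openE => _ [p [ap Up] <-]; rewrite /interior.
have nU := near_cinv ap (open_nbhs_nbhs (conj oU Up)).
apply: filterS2 nU (near_cinvK ap) => x Ux [ax xK].
by exists (cinv a x).
Qed.

End OneChart.

(** The part of the manifold structure on which the chain rule for [tangent_map] rests. It concerns
    preferred charts only, so model spaces and products have it at once. *)
Definition well_charted (M : topologicalType) (E : normedModType R)
    (C : charted M E) :=
  forall p, is_chart (chart_at C p) /\ cdom (chart_at C p) p.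

Lemma well_charted_manifold (M : topologicalType) (E : normedModType R)
  (C : charted M E) : is_smooth_manifold C -> well_charted C.
Proof.
move=> mC p; split; last exact: chart_at_dom mC p.
exact: (atlas_chart mC (chart_at_atlas mC p)).
Qed.

Lemma is_chart_model (E : normedModType R) : is_chart (Chart setT (@id E) (@id E)).
Proof.
split=> //=; [exact: openT|rewrite image_id; exact: openT| |];
  by move=> p _; exact: cvg_id.
Qed.

Lemma well_charted_model (E : normedModType R) : well_charted (model E).
Proof. by move=> p; split=> //; exact: is_chart_model. Qed.

Lemma is_chart_prod (M N : topologicalType) (E F : normedModType R)
    (a : chart M E) (b : chart N F) :
  is_chart a -> is_chart b -> is_chart (prod_chart a b).
Proof.
move=> ca cb; split=> /=.
- rewrite openE => -[p q] [/= ap bq]; rewrite /interior.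
  exists (cdom a, cdom b) => //.
  by split; apply: open_nbhs_nbhs; split=> //; [exact: cdom_open ca|exact: cdom_open cb].
- rewrite openE => _ [[p q] [/= ap bq] <-]; rewrite /interior.
  exists (cmap a @` cdom a, cmap b @` cdom b).
    split; apply: open_nbhs_nbhs; split=> /=.
    - exact: cimage_open ca.
    - by exists p.
    - exact: cimage_open cb.
    - by exists q.
  by move=> [x y] [/= [p' ap' <-] [q' bq' <-]]; exists (p', q').
- by move=> [p q] [/= ap bq]; rewrite (cmapK ca ap) (cmapK cb bq).
- move=> [p q] [/= ap bq]; apply: cvg_pair.
    apply: (@continuous_comp _ _ _ fst (cmap a) (p, q)); first exact: cvg_fst.
    exact: (cmap_continuous ca ap).
  apply: (@continuous_comp _ _ _ snd (cmap b) (p, q)); first exact: cvg_snd.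
  exact: (cmap_continuous cb bq).
- move=> [p q] [/= ap bq]; apply: cvg_pair.
    apply: (@continuous_comp _ _ _ fst (cinv a) (cmap a p, cmap b q)).
      exact: cvg_fst.
    exact: (cinv_continuous ca ap).
  apply: (@continuous_comp _ _ _ snd (cinv b) (cmap a p, cmap b q)).
    exact: cvg_snd.
  exact: (cinv_continuous cb bq).
Qed.

Lemma well_charted_prod (M N : topologicalType) (E F : normedModType R)
    (C : charted M E) (D : charted N F) :
  well_charted C -> well_charted D -> well_charted (prod_charted C D).
Proof.
move=> wC wD [p q]; have [cp pp] := wC p; have [cq qq] := wD q.
by split; [exact: is_chart_prod|split].
Qed.

End Charts.

(** * Differentiable maps between manifolds and the chain rule *)

Section Tangent.
Context {R : realType}.

(** Continuity is a separate clause: [local_expr] reads the values of [f] through one [cmap], which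
    is arbitrary outside its domain, so its differentiability does not keep nearby values of [f] in
    that domain. *)
Definition diff_at (M N : topologicalType) (E F : normedModType R)
    (C : charted M E) (D : charted N F) (f : M -> N) (p : M) :=
  {for p, continuous f} /\
  differentiable (local_expr C D f p) (cmap (chart_at C p) p).

Section Maps.
Context {M N : topologicalType} {E F : normedModType R}.
Variables (C : charted M E) (D : charted N F).

Lemma smooth_at_diff_at f p : smooth_at C D f p -> diff_at C D f p.
Proof.
by move=> [cf [W [oW Wp] /(_ 1%N) [df _]]]; split=> //; exact: df.
Qed.

Lemma near_diff_at f g p : well_charted C -> {near p, f =1 g} ->
  diff_at C D f p ->
  diff_at C D g p /\ forall v, tangent_map C D g p v = tangent_map C D f p v.
Proof.
move=> wC fg [cf df]; have fgp := nbhs_singleton fg.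
have [cp pp] := wC p.
have lfg : {near cmap (chart_at C p) p, local_expr C D f p =1 local_expr C D g p}.
  have := near_cinv cp pp fg; apply: filterS => x fgx.
  by rewrite /local_expr /= fgx fgp.
have [dg eg] := differentiable_near lfg df.
split=> //; split=> //; have := cf.
by rewrite /prop_for /continuous_at fgp; apply: cvg_trans; exact: near_eq_cvg.
Qed.

Lemma const_diff_at (q : N) p : 
  diff_at C D (fun=> q) p /\ forall v, tangent_map C D (fun=> q) p v = 0.
Proof.
have [d e] := differentiable_const (cmap (chart_at D q) q) (cmap (chart_at C p) p).
split; last exact: e.
by split; [exact: cst_continuous|exact: d].
Qed.

End Maps.

Lemma comp_diff_at (M N P : topologicalType) (E F G : normedModType R)
    (C : charted M E) (D : charted N F) (K : charted P G) f g p :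
  well_charted C -> well_charted D ->
  diff_at C D f p -> diff_at D K g (f p) ->
  diff_at C K (fun x => g (f x)) p /\
  forall v, tangent_map C K (fun x => g (f x)) p v =
            tangent_map D K g (f p) (tangent_map C D f p v).
Proof.
move=> wC wD [cf df] [cg dg].
have [cp pp] := wC p; have [cfp fpp] := wD (f p).
have lfp : local_expr C D f p (cmap (chart_at C p) p) = cmap (chart_at D (f p)) (f p).
  by rewrite /local_expr /= (cmapK cp pp).
have dg' : differentiable (local_expr D K g (f p))
    (local_expr C D f p (cmap (chart_at C p) p)) by rewrite lfp.
have [d e] := differentiable_compose df dg'.
(* The chart at [f p] and its inverse cancel only on the chart domain; continuity of [f] keeps
   nearby values there. *)
have nl : {near cmap (chart_at C p) p,
    (fun x => local_expr D K g (f p) (local_expr C D f p x)) =1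
    local_expr C K (fun x => g (f x)) p}.
  have := near_cinv cp pp (cf _ (near_cmapK cfp fpp)).
  by apply: filterS => x; rewrite /local_expr /= => ->.
have [d2 e2] := differentiable_near nl d.
split; first by split=> //; exact: continuous_comp cf cg.
move=> v; apply: etrans (e2 v) _; apply: etrans (e v) _.
by rewrite lfp.
Qed.

Lemma pair_diff_at (M N P : topologicalType) (E F G : normedModType R)
    (C : charted M E) (D : charted N F) (K : charted P G) f g p :
  diff_at C D f p -> diff_at C K g p ->
  diff_at C (prod_charted D K) (fun x => (f x, g x)) p /\
  forall v, tangent_map C (prod_charted D K) (fun x => (f x, g x)) p v =
            (tangent_map C D f p v, tangent_map C K g p v).
Proof.
move=> [cf df] [cg dg]; have [d e] := differentiable_prod df dg.
by split; [split; [exact: cvg_pair cf cg|exact: d]|exact: e].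
Qed.

Lemma id_diff_at (M : topologicalType) (E : normedModType R) (C : charted M E) p :
  well_charted C ->
  diff_at C C (fun x => x) p /\ forall v, tangent_map C C (fun x => x) p v = v.
Proof.
move=> wC; have [cp pp] := wC p.
have [d e] := differentiable_id (cmap (chart_at C p) p).
have nl : {near cmap (chart_at C p) p, (fun x => x) =1 local_expr C C (fun x => x) p}.
  by apply: filterS (near_cinvK cp pp) => x [_ /esym].
have [d2 e2] := differentiable_near nl d.
split; first by split=> //; exact: cvg_id.
by move=> v; rewrite /tangent_map; apply: etrans (e2 v) (e v).
Qed.

End Tangent.

(** * Vector fields on a smooth manifold *)

Section SmoothManifold.
Context {R : realType} {M : topologicalType} {E : normedModType R}.
Variables (C : charted M E).
Hypotheses (mC : is_smooth_manifold C) (fE : finite_dim E).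

Let wC : well_charted C := well_charted_manifold mC.
Let wE : well_charted (model E) := @well_charted_model R E.
Let domP p : cdom (chart_at C p) p := (wC p).2.
Let at_atlas p : atlas C (chart_at C p) := chart_at_atlas mC p.
Let atlasP a : atlas C a -> is_chart a := atlas_chart mC (a := a).

Definition transition_dom (a b : chart M E) := cmap a @` (cdom a `&` cdom b).

Lemma transition_dom_open a b : atlas C a -> atlas C b -> open (transition_dom a b).
Proof.
move=> Ca Cb; apply: cmap_image_open; first exact: atlasP.
exact: cdom_open (atlasP Cb).
Qed.

Lemma transition_differentiable a b p : atlas C a -> atlas C b ->
  cdom a p -> cdom b p -> differentiable (cmap b \o cinv a) (cmap a p).
Proof.
move=> Ca Cb ap bp; have [d _] := transition_smooth mC Ca Cb 1%N.
by apply: d; exists p.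
Qed.

Lemma cmap_diff_at a p : atlas C a -> cdom a p -> diff_at C (model E) (cmap a) p.
Proof.
move=> Ca ap; split; first exact: (cmap_continuous (atlasP Ca) ap).
exact: (transition_differentiable (at_atlas p) Ca (domP p) ap).
Qed.

Lemma cinv_diff_at a p : atlas C a -> cdom a p ->
  diff_at (model E) C (cinv a) (cmap a p).
Proof.
move=> Ca ap; split; first exact: (cinv_continuous (atlasP Ca) ap).
rewrite /local_expr (cmapK (atlasP Ca) ap).
exact: (transition_differentiable Ca (at_atlas p) ap (domP p)).
Qed.

Lemma components_chart_at p v : components C (chart_at C p) p v = v.
Proof. exact: (id_diff_at p wC).2. Qed.

Lemma cinv_components a p v : atlas C a -> cdom a p ->
  tangent_map (model E) C (cinv a) (cmap a p) (components C a p v) = v.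
Proof.
move=> Ca ap; have ca := atlasP Ca.
have d := cinv_diff_at Ca ap.
have [d2 e2] := comp_diff_at wC wE (cmap_diff_at Ca ap) d.
have [d1 e1] := id_diff_at p wC.
have n : {near p, (fun q => q) =1 fun q => cinv a (cmap a q)}.
  by apply: filterS (near_cmapK ca ap) => q /esym.
have [_ e3] := near_diff_at wC n d1.
by apply: etrans (esym (e2 v)) _; apply: etrans (e3 v) (e1 v).
Qed.

Lemma components_cinv a p v : atlas C a -> cdom a p ->
  components C a p (tangent_map (model E) C (cinv a) (cmap a p) v) = v.
Proof.
move=> Ca ap; have ca := atlasP Ca.
have d : diff_at C (model E) (cmap a) (cinv a (cmap a p)).
  by rewrite (cmapK ca ap); exact: cmap_diff_at.
have [d2 e2] := comp_diff_at wE wC (cinv_diff_at Ca ap) d.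
have [d1 e1] := id_diff_at (cmap a p) wE.
have n : {near cmap a p, (fun q => q) =1 fun q => cmap a (cinv a q)}.
  by apply: filterS (near_cinvK ca ap) => q [_ /esym].
have [_ e3] := near_diff_at wE n d1.
have := e2 v; rewrite (cmapK ca ap) => e2v.
by apply: etrans (esym e2v) _; exact: etrans (e3 v) (e1 v).
Qed.

Lemma components_change a b p v : atlas C a -> atlas C b -> cdom a p -> cdom b p ->
  components C b p v = 'd (cmap b \o cinv a) (cmap a p) (components C a p v).
Proof.
move=> Ca Cb ap bp.
have d : diff_at C (model E) (cmap b) (cinv a (cmap a p)).
  by rewrite (cmapK (atlasP Ca) ap); exact: cmap_diff_at.
have [_ e] := comp_diff_at wE wC (cinv_diff_at Ca ap) d.
apply: esym; apply: etrans (e _) _.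
by rewrite (cmapK (atlasP Ca) ap) cinv_components.
Qed.

Lemma field_in_chartE a X p : atlas C a -> cdom a p ->
  field_in_chart C a X (cmap a p) = components C a p (X p).
Proof. by move=> Ca ap; rewrite /field_in_chart (cmapK (atlasP Ca) ap). Qed.

Lemma field_in_chart_at X p :
  field_in_chart C (chart_at C p) X (cmap (chart_at C p) p) = X p.
Proof. by rewrite field_in_chartE // components_chart_at. Qed.

Lemma dirderiv_chart (F : normedModType R) (f : M -> F) a p v :
  atlas C a -> cdom a p -> diff_at C (model F) f p ->
  differentiable (fun x => f (cinv a x)) (cmap a p) /\
  'd (fun x => f (cinv a x)) (cmap a p) (components C a p v) =
  tangent_map C (model F) f p v.
Proof.
move=> Ca ap df.
have df' : diff_at C (model F) f (cinv a (cmap a p)).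
  by rewrite (cmapK (atlasP Ca) ap).
have [[_ d] e] := comp_diff_at wE wC (cinv_diff_at Ca ap) df'.
split; first exact: d.
apply: etrans (e _) _.
by rewrite (cmapK (atlasP Ca) ap) cinv_components.
Qed.

Lemma near_cdom a p : atlas C a -> cdom a p -> \forall q \near p, cdom a q.
Proof.
move=> Ca ap.
by apply: open_nbhs_nbhs; split=> //; exact: cdom_open (atlasP Ca).
Qed.

(** Smoothness at [q] is measured in the preferred chart at [q], not in the one at [p]. On the
    overlap the new components are the Jacobian of the transition map applied to the old ones,
    precomposed with the inverse transition. *)
Lemma smooth_field_near X p : smooth_field_at C X p ->
  \forall q \near p, smooth_field_at C X q.
Proof.
move=> [W [oW Wp] sW]; set a := chart_at C p in oW Wp sW *.
have Ca : atlas C a := at_atlas p.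
have ap : cdom a p := domP p.
have nW : \forall q \near p, W (cmap a q).
  exact: (cmap_continuous (atlasP Ca) ap (open_nbhs_nbhs (conj oW Wp))).
apply: filterS2 nW (near_cdom Ca ap) => q /= Wq aq.
pose b := chart_at C q; have Cb : atlas C b := at_atlas q.
have bq : cdom b q := domP q.
pose T := transition_dom a b `&` W; pose S := transition_dom b a.
have oT : open T by apply: openI => //; exact: transition_dom_open.
have oS : open S by exact: transition_dom_open.
pose sg := cmap a \o cinv b.
(* The second [cdom a] is there for openness: [cmap a] is continuous on its domain only, so the
   preimage of [W] is cut down to it. *)
pose V := cmap b @` (cdom b `&` (cdom a `&` (cmap a @^-1` W `&` cdom a))).
have oV : open V.
  apply: cmap_image_open; first exact: atlasP.
  apply: openI; first exact: cdom_open (atlasP Ca).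
  rewrite openE => r [Wr ar]; rewrite /interior.
  apply: filterI; last exact: near_cdom.
  exact: (cmap_continuous (atlasP Ca) ar (open_nbhs_nbhs (conj oW Wr))).
exists V => [|k].
  by split=> //; exists q.
have sgT x : V x -> T (sg x).
  move=> [r [br [ar [Wr _]]] <-]; rewrite /sg /= (cmapK (atlasP Cb) br).
  by split=> //; exists r.
have VS : V `<=` S.
  by move=> _ [r [br [ar _]] <-]; exists r.
have C1 : Ck k V sg by apply: Ck_sub VS _; exact: (transition_smooth mC Cb Ca k).
(* The Jacobian costs one derivative, hence order [k.+1] for the transition map. *)
have C2 : Ck k T (fun z => 'd (cmap b \o cinv a) z (field_in_chart C a X z)).
  apply: Ck_diff_field => //.
    apply: (@Ck_sub _ _ _ _ (transition_dom a b)); first by move=> ? [].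
    exact: (transition_smooth mC Ca Cb k.+1).
  by apply: Ck_sub (sW k); move=> ? [].
have C3 := Ck_comp fE oV oT sgT C1 C2.
apply: Ck_ext C3 => // x; rewrite inE => -[r [br [ar _]] <-].
rewrite /sg /= (cmapK (atlasP Cb) br) (field_in_chartE _ Ca ar) -/b.
rewrite (field_in_chartE _ Cb br).
by rewrite (components_change _ Ca Cb ar br).
Qed.

Lemma smooth_field_differentiable X p : smooth_field_at C X p ->
  differentiable (field_in_chart C (chart_at C p) X) (cmap (chart_at C p) p).
Proof. by move=> [W [oW Wp] /(_ 1%N) [d _]]; exact: d. Qed.

Lemma smooth_field_add X Y p : smooth_field_at C X p -> smooth_field_at C Y p ->
  smooth_field_at C (fun q => X q + Y q) p.
Proof.
move=> [W [oW Wp] sX] [W' [oW' Wp'] sY].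
exists (W `&` W') => [|k]; first by split=> //; exact: openI.
have oWW : open (W `&` W') by exact: openI.
have CX : Ck k (W `&` W') _ := Ck_sub (@subIsetl _ W W') (sX k).
have CY : Ck k (W `&` W') _ := Ck_sub (@subIsetr _ W W') (sY k).
apply: Ck_ext (Ck_add oWW CX CY) => // x _.
by rewrite /field_in_chart /components /tangent_map linearD.
Qed.

Lemma coord_field_in_chart a u p : atlas C a -> cdom a p ->
  field_in_chart C a (coord_field C a u) (cmap a p) = u.
Proof. by move=> Ca ap; rewrite field_in_chartE // components_cinv. Qed.

Lemma smooth_coord_field p u :
  smooth_field_at C (coord_field C (chart_at C p) u) p.
Proof.
set a := chart_at C p; have Ca : atlas C a := at_atlas p.
have oI := cimage_open (atlasP Ca).
exists (cmap a @` cdom a) => [|k].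
  by split; [exact: oI|exists p; first exact: domP].
apply: Ck_ext (Ck_const k u oI) => // x; rewrite inE => -[q aq <-].
by rewrite (coord_field_in_chart _ Ca aq).
Qed.

Lemma lie_bracket_dirderiv (f : M -> R) X Y p :
  (\forall q \near p, diff_at C (model R) f q) -> smooth_at C (model R) f p ->
  smooth_field_at C X p -> smooth_field_at C Y p ->
  dirderiv C (fun q => dirderiv C f q (Y q)) p (X p)
  - dirderiv C (fun q => dirderiv C f q (X q)) p (Y p)
  = dirderiv C f p (lie_bracket C X Y p).
Proof.
move=> nf sf sX sY.
set a := chart_at C p; have Ca : atlas C a := at_atlas p.
have ca := atlasP Ca.
have ap : cdom a p := domP p.
have [_ [W [oW Wp] sW]] := sf.
pose f' := fun x => f (cinv a x).
have C2 : Ck 2 W f' := sW 2%N.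
have fR : finite_dim R.
  exists 1%N, (fun=> 1), (fun=> idfun); split=> [i|x].
    by split=> // x; exact: cvg_id.
  by rewrite big_ord1 /= /GRing.scale /= mulr1.
(* The inner [dirderiv] at [q] uses the preferred chart at [q]; for [q] near [p] it is rewritten in
   the chart at [p], so that the iterated derivative becomes one of [f']. *)
have H Z v : smooth_field_at C Z p ->
    dirderiv C (fun q => dirderiv C f q (Z q)) p v =
    'd (fun x => 'd f' x (field_in_chart C a Z x)) (cmap a p) v.
  move=> sZ; have dZ := smooth_field_differentiable sZ.
  have [d e] := differentiable_diff_field fE oW Wp C2 dZ.
  apply: near_diff d.
  have := near_cinv ca ap nf; apply: filterS2 (near_cinvK ca ap) => x [ax xK] dfx.
  have [_ e1] := dirderiv_chart (Z (cinv a x)) Ca ax dfx.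
  rewrite /field_in_chart; apply: etrans _ e1.
  by rewrite xK.
have dX := smooth_field_differentiable sX.
have dY := smooth_field_differentiable sY.
have := diff_field_antisym fE fR oW Wp C2 dX dY.
rewrite !field_in_chart_at => K.
exact: etrans (congr2 (fun a b => a - b) (H Y (X p) sY) (H X (Y p) sX)) K.
Qed.

Lemma diff0_const (f : M -> R) p :
  (forall q, diff_at C (model R) f q) ->
  (forall q v, dirderiv C f q v = 0) ->
  \forall q \near p, f q = f p.
Proof.
move=> df f0.
set a := chart_at C p; have Ca : atlas C a := at_atlas p.
have ca := atlasP Ca.
have ap : cdom a p := domP p.
have /nbhs_ballP[r /= r0 Br] := near_cinvK ca ap.
have H y : ball (cmap a p) r y -> differentiable (fun x => f (cinv a x)) y /\
    forall v, 'd (fun x => f (cinv a x)) y v = 0.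
  move=> /Br [ay yK].
  have D v := dirderiv_chart v Ca ay (df (cinv a y)).
  split; first by have [] := D 0; rewrite yK.
  move=> v; have := components_cinv v Ca ay; rewrite yK => <-.
  have [_] := D (tangent_map (model E) C (cinv a) y v); rewrite yK => e.
  exact: etrans e (f0 _ _).
have K := const_of_diff0 H.
have nb : \forall q \near p, ball (cmap a p) r (cmap a q).
  exact: (cmap_continuous ca ap (nbhsx_ballx _ r r0)).
apply: filterS2 nb (near_cmapK ca ap) => q /= /K.
by rewrite (cmapK ca ap) => <- ->.
Qed.

End SmoothManifold.

(** The level set of [f] through [x] and its complement are both open; the connected image of a path
    from [x] to [y] cannot leave it. *)
Lemma path_connected_const (R : realType) (T : topologicalType) (f : T -> R) :
  (forall x y : T, exists c : R -> T,
     [/\ {within `[0, 1], continuous c}, c 0 = x & c 1 = y]) ->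
  (forall x, \forall y \near x, f y = f x) -> forall x y, f x = f y.
Proof.
move=> pc lf x y.
have [c [cc c0 c1]] := pc x y.
have cn : connected (c @` `[0, 1]).
  by apply: connected_continuous_connected => //; exact: segment_connected.
have oP (P : set R) : open [set z | P (f z)].
  by rewrite openE => z Pz; rewrite /interior; apply: filterS (lf z) => w; rewrite /= => ->.
have xA : (c @` `[0, 1]) x by exists 0 => //=; rewrite in_itv /= lexx ler01.
have yA : (c @` `[0, 1]) y by exists 1 => //=; rewrite in_itv /= lexx ler01.
have : c @` `[0, 1] `&` [set z | f z = f x] = c @` `[0, 1].
  apply: cn.
  - by exists x.
  - by exists [set z | f z = f x] => //; exact: (oP [set r | r = f x]).
  - exists [set z | f z = f x] => //.
    by rewrite -[X in closed X]setCK; apply: open_closedC; exact: (oP [set r | r <> f x]).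
by move/seteqP => [_ /(_ y yA)[_ ->]].
Qed.

(** * Parallel fields *)

Section MetricAlgebra.
Context {R : realType} {M : topologicalType} {E : normedModType R}.
Variables (C : charted M E) (Q : M -> E -> E -> R).
Hypothesis metricQ : pseudo_riemannian_metric C Q.

Lemma metric_Dr p u v w : Q p u (v + w) = Q p u v + Q p u w.
Proof. by have := metric_linear metricQ p u 1 v w; rewrite scale1r mul1r. Qed.

Lemma metric_0r p u : Q p u 0 = 0.
Proof. by apply: (addrI (Q p u 0)); rewrite -metric_Dr !addr0. Qed.

Lemma metric_Zr p u k v : Q p u (k *: v) = k * Q p u v.
Proof. by have := metric_linear metricQ p u k v 0; rewrite metric_0r !addr0. Qed.

Lemma metric_Br p u v w : Q p u (v - w) = Q p u v - Q p u w.
Proof. by rewrite metric_Dr -scaleN1r metric_Zr mulN1r. Qed.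

Lemma metric_Dl p u v w : Q p (u + v) w = Q p u w + Q p v w.
Proof. by rewrite !(Defs.metric_sym metricQ p _ w) metric_Dr. Qed.

Lemma metric_0l p u : Q p 0 u = 0.
Proof. by rewrite (Defs.metric_sym metricQ) metric_0r. Qed.

Lemma metric_Zl p u k v : Q p (k *: u) v = k * Q p u v.
Proof. by rewrite !(Defs.metric_sym metricQ p _ v) metric_Zr. Qed.

Lemma metric_Bl p u v w : Q p (u - v) w = Q p u w - Q p v w.
Proof. by rewrite !(Defs.metric_sym metricQ p _ w) metric_Br. Qed.

Lemma metric_suml p m (f : 'I_m -> E) v :
  Q p (\sum_i f i) v = \sum_i Q p (f i) v.
Proof.
elim/big_ind2: _ => [|x y z w <- <-|//]; first exact: metric_0l.
exact: metric_Dl.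
Qed.

End MetricAlgebra.

Section ParallelFrame.
Context {R : realType} {M : topologicalType} {E : normedModType R}.
Variables (C : charted M E) (Q : M -> E -> E -> R).
Variable (nabla : M -> E -> (M -> E) -> E).
Hypotheses (mC : is_smooth_manifold C) (fE : finite_dim E).
Hypothesis metricQ : pseudo_riemannian_metric C Q.
Hypothesis LC : levi_civita C Q nabla.

Let aff : affine_connection C nabla := levi_civita_connection LC.
Let wC : well_charted C := well_charted_manifold mC.

Lemma connection0 p Y : smooth_field_at C Y p -> nabla p 0 Y = 0.
Proof.
move=> sY; have := connection_linear aff sY 1 0 0.
rewrite /= !scale1r !addr0 => h; apply: (addrI (nabla p 0 Y)).
by rewrite -h addr0.
Qed.

Lemma metric_diff_at X Y p : smooth_field_at C X p -> smooth_field_at C Y p ->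
  diff_at C (model R) (fun q => Q q (X q) (Y q)) p.
Proof. by move=> sX sY; apply/smooth_at_diff_at/(metric_smooth metricQ). Qed.

Definition parallel_field (W : M -> E) :=
  (forall p, smooth_field_at C W p) /\ (forall p v, nabla p v W = 0).

Lemma dirderiv_metric_parallel W Z p v : parallel_field W ->
  smooth_field_at C Z p ->
  dirderiv C (fun q => Q q (Z q) (W q)) p v = Q p (nabla p v Z) (W p).
Proof.
move=> [sW pW] sZ.
by rewrite (levi_civita_metric LC) // pW (metric_0r metricQ) addr0.
Qed.

Lemma curvature_orthogonal W X Y Z p : parallel_field W ->
  smooth_field_at C X p -> smooth_field_at C Y p -> smooth_field_at C Z p ->
  Q p (curvature C nabla X Y Z p) (W p) = 0.
Proof.
move=> pW sX sY sZ; have [sW _] := pW.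
pose phi q := Q q (Z q) (W q).
have nphi : \forall q \near p, diff_at C (model R) phi q.
  apply: filterS (smooth_field_near mC fE sZ) => q sZq; exact: metric_diff_at.
have sphi : smooth_at C (model R) phi p by exact: (metric_smooth metricQ).
have H A v : smooth_field_at C A p ->
    dirderiv C (fun q => dirderiv C phi q (A q)) p v =
    Q p (nabla p v (fun q => nabla q (A q) Z)) (W p).
  move=> sA.
  have sN : smooth_field_at C (fun q => nabla q (A q) Z) p.
    exact: (connection_smooth aff).
  rewrite -(dirderiv_metric_parallel _ pW sN).
  (* [Z] is smooth only near [p], so the identity holds between germs, which is all that the outer
     derivative sees. *)
  have n : {near p, (fun q => Q q (nabla q (A q) Z) (W q)) =1
                    fun q => dirderiv C phi q (A q)}.
    apply: filterS (smooth_field_near mC fE sZ) => q sZq.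
    by rewrite /phi dirderiv_metric_parallel.
  exact: (near_diff_at wC n (metric_diff_at sN (sW p))).2.
rewrite /curvature !(metric_Bl metricQ) -!H // -dirderiv_metric_parallel //.
by rewrite (lie_bracket_dirderiv mC fE nphi sphi sX sY) subrr.
Qed.

Lemma coord_field_at p v : coord_field C (chart_at C p) v p = v.
Proof.
have := cinv_components mC v (chart_at_atlas mC p) (chart_at_dom mC p).
by rewrite components_chart_at.
Qed.

(** Metric compatibility speaks of fields on [M], while [V] lives on the curve only. In the chart at
    [c t], [V s] is the coordinate field extending [V t] plus a combination of the fields extending
    the [e i], with coefficients that vanish at [s = t]. The first term contributes the [nabla] part
    of the covariant derivative, the second its ['D_1] part; both are paired with [W], and their sum
    is zero. *)
Lemma is_derive_metric_parallel W (c : R -> M) (V : R -> E) t :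
  parallel_field W -> smooth_at (model R) C c t -> parallel_at C nabla c V t ->
  is_derive t (1 : R) (fun s => Q (c s) (V s) (W (c s))) 0.
Proof.
move=> pW sc [dV eV]; have [sW _] := pW.
have dc := smooth_at_diff_at sc; have cc := dc.1.
set p := c t in dV eV dc cc *; set a := chart_at C p in dV eV *.
have Ca : atlas C a := chart_at_atlas mC p.
have ap : cdom a p := chart_at_dom mC p.
have [m [e [k [kl ke]]]] := fE.
set V' := (fun s => components C a (c s) (V s)) in dV eV.
have V't : V' t = V t by rewrite /V' -/p components_chart_at.
pose phi i q := Q q (coord_field C a (e i) q) (W q).
pose psi q := Q q (coord_field C a (V t) q) (W q).
have wR := @well_charted_model R R.
have sF u : smooth_field_at C (coord_field C a u) p := smooth_coord_field mC p u.
have [dpsi epsi] := comp_diff_at wR wC dc (metric_diff_at (sF (V t)) (sW p)).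
have dphi i := (comp_diff_at wR wC dc (metric_diff_at (sF (e i)) (sW p))).1.
have dV' : differentiable V' t by exact/derivable1_diffP.
have [dU eU] := differentiable_sub dV' (differentiable_const (V t) t).1.
have dk i := differentiable_compose dU
  (differentiable_linear (V' t - V t) (kl i).1 (kl i).2).1.
have ds i := differentiable_scale (dk i).1 (dphi i).2.
have [dS eS] := differentiable_bigsum (fun i => (ds i).1).
have [dg eg] := differentiable_add dpsi.2 dS.
have n : {near t, (fun s => psi (c s) + \sum_i k i (V' s - V t) *: phi i (c s))
    =1 fun s => Q (c s) (V s) (W (c s))}.
  have nc : \forall s \near t, cdom a (c s) := cc _ (near_cdom mC Ca ap).
  apply: filterS nc => s acs.
  have -> : V s = coord_field C a (V t) (c s) +
      \sum_i k i (V' s - V t) *: coord_field C a (e i) (c s).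
    have := cinv_components mC (V s) Ca acs; rewrite -/(V' s) => {1}<-.
    rewrite /coord_field /tangent_map -diff_sum_basis -ke -linearD.
    by rewrite addrC subrK.
  rewrite (metric_Dl metricQ) (metric_suml metricQ); congr (_ + _).
  by apply: eq_bigr => i _; rewrite (metric_Zl metricQ).
have [dG eG] := differentiable_near n dg.
apply: DeriveDef; first exact: diff_derivable.
rewrite (deriveE _ dG); apply: etrans (eG 1) _; apply: etrans (eg 1) _.
have E1 : 'd (fun s => psi (c s)) t 1 =
    Q p (nabla p (velocity C c t) (coord_field C a (V t))) (W p).
  by apply: etrans (epsi 1) _; exact: dirderiv_metric_parallel.
have E2 : 'd (fun s => \sum_i k i (V' s - V t) *: phi i (c s)) t 1 =
    Q p ('D_1 V' t) (W p).
  apply: etrans (eS 1) _.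
  rewrite [in RHS](ke ('D_1 V' t)) (metric_suml metricQ); apply: eq_bigr => i _.
  apply: etrans ((ds i).2 1) _.
  (* The coefficient vanishes at [t], so the derivative of [phi i] drops out of the Leibniz rule. *)
  rewrite V't subrr.
  have k0 : k i 0 = 0.
    by have := (kl i).1 (-1) 0 0; rewrite scaler0 addr0 scaleN1r addNr.
  have phip : phi i p = Q p (e i) (W p).
    by rewrite /phi (coord_field_at p (e i) : coord_field C a (e i) p = e i).
  rewrite k0 scale0r add0r -[local_expr _ _ _ _ _]/(phi i p) phip.
  rewrite (metric_Zl metricQ).
  congr (_ * _); apply: etrans ((dk i).2 1) _.
  have [_ el] := differentiable_linear (V' t - V t) (kl i).1 (kl i).2.
  apply: etrans (el _) _; congr (k i _).
  apply: etrans (eU 1) _; rewrite (deriveE _ dV').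
  apply: etrans (congr2 (fun x y => x - y) erefl
    ((differentiable_const (V t) t).2 1)) _.
  by rewrite subr0.
apply: etrans (congr2 +%R E1 E2) _.
have eV' : 'D_1 V' t + nabla p (velocity C c t) (coord_field C a (V t)) = 0 := eV.
by rewrite -(metric_Dl metricQ) addrC eV' (metric_0l metricQ).
Qed.

Lemma parallel_transport_metric W p q P v : parallel_field W ->
  parallel_transport C nabla p q P -> Q q (P v) (W q) = Q p v (W p).
Proof.
move=> pW tP; elim: tP v => {p q P}
    [c P e e0 sc HV|p q r P P' _ IH _ IH'] v; last by rewrite /= IH' IH.
have [V [V0 V1 pV]] := HV v; rewrite -V1 -[in RHS]V0.
pose g s := Q (c s) (V s) (W (c s)).
have D (t : R) : 0 <= t <= 1 -> is_derive t (1 : R) g 0.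
  move=> /andP[t0 t1].
  (* The margin [e] provides two-sided derivatives at the end points 0 and 1 too. *)
  have te : - e < t < 1 + e.
    rewrite (lt_le_trans _ t0) ?oppr_lt0 //=.
    by rewrite (le_lt_trans t1) // ltrDl.
  by apply: is_derive_metric_parallel => //; [exact: sc|exact: pV].
have [||s _ /eqP] := @MVT_segment R g (fun=> 0) 0 1 ler01.
- by move=> t; rewrite in_itv /= => /andP[/ltW t0 /ltW t1]; apply: D; rewrite t0.
- apply: derivable_within_continuous => t; rewrite in_itv /= => ts.
  by have [] := D t ts.
by rewrite mul0r subr_eq0 => /eqP.
Qed.

(** The constant path has zero velocity, so constant [V] is parallel along it. This puts [id] in the
    holonomy group. *)
Lemma parallel_transport_id p : parallel_transport C nabla p p id.
Proof.
apply: (@transport_smooth _ _ _ C nabla (fun=> p) id 1) => //.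
  move=> t _; split; first exact: cst_continuous.
  exists setT; first by split=> //; exact: openT.
  by move=> k; apply: Ck_const; exact: openT.
move=> v; exists (fun=> v); split=> // t _.
have [_ vel0] := @const_diff_at R R M R E (model R) C p t.
split; first exact: derivable_cst.
rewrite /covariant_derivative_along derive_cst add0r /velocity vel0.
by apply: connection0; exact: smooth_coord_field.
Qed.

Section Spanning.
Variables (I : Type) (W : I -> M -> E).
Hypothesis parW : forall i, parallel_field (W i).
(** Spanning is phrased as a trivial orthogonal complement, since curvature and transport are known
    only through their pairings with the [W i]. *)
Hypothesis spanW : forall p z, (forall i, Q p z (W i p) = 0) -> z = 0.

Lemma curvature0 X Y Z p :
  smooth_field_at C X p -> smooth_field_at C Y p -> smooth_field_at C Z p ->
  curvature C nabla X Y Z p = 0.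
Proof.
by move=> sX sY sZ; apply: (spanW (p := p)) => i; exact: curvature_orthogonal.
Qed.

Lemma holonomy_trivial p : holonomy_group C nabla p = [set id].
Proof.
apply/seteqP; split=> [P tP|_ ->]; last exact: parallel_transport_id.
apply/funext => v; apply/eqP; rewrite -subr_eq0; apply/eqP.
apply: (spanW (p := p)) => i.
by rewrite (metric_Bl metricQ) (parallel_transport_metric _ (parW i) tP) subrr.
Qed.

End Spanning.
End ParallelFrame.

(** * Lie groups *)

Section Partial.
Context {R : realType}.
Implicit Types E F G : normedModType R.

Lemma diff_partial2 E F G (h : E * F -> G) x z w : differentiable h (x, z) ->
  'd (fun z' => h (x, z')) z w = 'd h (x, z) (0, w).
Proof.
move=> dh; have [dc ec] := differentiable_const x z.
have [di ei] := differentiable_id z.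
have [dp ep] := differentiable_prod dc di.
have [_ e] := differentiable_compose dp dh.
apply: etrans (e w) _; congr ('d h _ _); apply: etrans (ep w) _.
by apply: (congr2 (@pair E F)); [exact: ec|exact: ei].
Qed.

Lemma diff_partial1 E F G (h : E * F -> G) x z w : differentiable h (x, z) ->
  'd (fun x' => h (x', z)) x w = 'd h (x, z) (w, 0).
Proof.
move=> dh; have [dc ec] := differentiable_const z x.
have [di ei] := differentiable_id x.
have [dp ep] := differentiable_prod di dc.
have [_ e] := differentiable_compose dp dh.
apply: etrans (e w) _; congr ('d h _ _); apply: etrans (ep w) _.
by apply: (congr2 (@pair E F)); [exact: ei|exact: ec].
Qed.

Lemma differentiable_inr_snd E F G (Y : F -> G) (p : E * F) : differentiable Y p.2 ->
  differentiable (fun z : E * F => (0 : E, Y z.2)) p /\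
  forall v, 'd (fun z : E * F => (0 : E, Y z.2)) p v = (0, 'd Y (p.2) v.2).
Proof.
move=> dY; have [dc ec] := differentiable_const (0 : E) p.
have l : linear (@snd E F) by move=> k a b.
have cs : continuous (@snd E F) by move=> a; exact: cvg_snd.
have [ds es] := differentiable_linear p l cs.
have [dk ek] := differentiable_compose ds dY.
have [dp ep] := differentiable_prod dc dk.
split=> [|v]; first exact: dp.
apply: etrans (ep v) _; apply: (congr2 (@pair E G)); first exact: ec.
exact: etrans (ek v) (congr1 ('d Y (p.2)) (es v)).
Qed.

Lemma differentiable_inl_fst E F G (X : E -> G) (p : E * F) : differentiable X p.1 ->
  differentiable (fun z : E * F => (X z.1, 0 : F)) p /\
  forall v, 'd (fun z : E * F => (X z.1, 0 : F)) p v = ('d X (p.1) v.1, 0).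
Proof.
move=> dX; have [dc ec] := differentiable_const (0 : F) p.
have l : linear (@fst E F) by move=> k a b.
have cs : continuous (@fst E F) by move=> a; exact: cvg_fst.
have [ds es] := differentiable_linear p l cs.
have [dk ek] := differentiable_compose ds dX.
have [dp ep] := differentiable_prod dk dc.
split=> [|v]; first exact: dp.
apply: etrans (ep v) _; apply: (congr2 (@pair G F)); last exact: ec.
exact: etrans (ek v) (congr1 ('d X (p.1)) (es v)).
Qed.
End Partial.

(** * Translations and invariant fields *)

Section LieGroups.
Context {R : realType} {n : nat} {N : groupTopologicalType}.
Variable C : charted N 'rV[R]_n.
Hypothesis lieC : is_lie_group C.

Let mC : is_smooth_manifold C := lie_group_manifold lieC.
Let wC : well_charted C := well_charted_manifold mC.
Let fE : finite_dim 'rV[R]_n := @finite_dim_rV R n.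
Let at_atlas p : atlas C (chart_at C p) := chart_at_atlas mC p.
Let domP p : cdom (chart_at C p) p := chart_at_dom mC p.
Let atlasP a : atlas C a -> is_chart a := atlas_chart mC (a := a).

Local Notation mul := (fun y : N * N => (y.1 * y.2)%g).
Local Notation L := (left_invariant_field C).

Definition right_invariant_field (u : 'rV[R]_n) : N -> 'rV[R]_n :=
  fun g => tangent_map C C (right_translation g) 1%g u.
Local Notation RI := right_invariant_field.

Lemma mul_diff_at x : diff_at (prod_charted C C) C mul x.
Proof. exact: smooth_at_diff_at (lie_group_mul_smooth lieC x). Qed.

Lemma left_translation_diff_at g h : diff_at C C (left_translation g) h.
Proof.
have [d _] := pair_diff_at (const_diff_at C C g h).1 (id_diff_at h wC).1.
exact: (comp_diff_at wC (well_charted_prod wC wC) d (mul_diff_at (g, h))).1.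
Qed.

Lemma right_translation_diff_at g h : diff_at C C (right_translation g) h.
Proof.
have [d _] := pair_diff_at (id_diff_at h wC).1 (const_diff_at C C g h).1.
exact: (comp_diff_at wC (well_charted_prod wC wC) d (mul_diff_at (h, g))).1.
Qed.

Lemma left_translationM g h k v :
  tangent_map C C (left_translation (g * h)%g) k v =
  tangent_map C C (left_translation g) (h * k)%g
    (tangent_map C C (left_translation h) k v).
Proof.
have [_ e] := comp_diff_at wC wC (left_translation_diff_at h k)
  (left_translation_diff_at g (h * k)%g).
apply: etrans _ (e v); congr (tangent_map C C _ k v).
by apply/funext => x; rewrite /left_translation mulgA.
Qed.

Lemma right_translationM g h k v :
  tangent_map C C (right_translation (g * h)%g) k v =
  tangent_map C C (right_translation h) (k * g)%g
    (tangent_map C C (right_translation g) k v).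
Proof.
have [_ e] := comp_diff_at wC wC (right_translation_diff_at g k)
  (right_translation_diff_at h (k * g)%g).
apply: etrans _ (e v); congr (tangent_map C C _ k v).
by apply/funext => x; rewrite /right_translation mulgA.
Qed.

Lemma left_invariant_field_push g h u :
  tangent_map C C (left_translation g) h (L u h) = L u (g * h)%g.
Proof.
by rewrite /left_invariant_field left_translationM mulg1.
Qed.

Lemma right_invariant_field_push g h u :
  tangent_map C C (right_translation h) g (RI u g) = RI u (g * h)%g.
Proof.
by rewrite /right_invariant_field right_translationM mul1g.
Qed.

Lemma left_translation1 h v : tangent_map C C (left_translation 1%g) h v = v.
Proof.
have -> : left_translation 1%g = (fun x : N => x).
  by apply/funext => x; rewrite /left_translation mul1g.
exact: (id_diff_at h wC).2.
Qed.

Lemma right_translation1 h v : tangent_map C C (right_translation 1%g) h v = v.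
Proof.
have -> : right_translation 1%g = (fun x : N => x).
  by apply/funext => x; rewrite /right_translation mulg1.
exact: (id_diff_at h wC).2.
Qed.

Lemma left_invariant_field1 u : L u 1%g = u.
Proof. exact: left_translation1. Qed.

Lemma right_invariant_field1 u : RI u 1%g = u.
Proof. exact: right_translation1. Qed.

Lemma left_invariant_field_surj g v : exists u, L u g = v.
Proof.
exists (tangent_map C C (left_translation g^-1%g) g v).
have := left_translationM g g^-1%g g v.
by rewrite mulgV mulVg left_translation1.
Qed.

Lemma right_invariant_field_surj g v : exists u, RI u g = v.
Proof.
exists (tangent_map C C (right_translation g^-1%g) g v).
have := right_translationM g^-1%g g g v.
by rewrite mulVg mulgV right_translation1.
Qed.

Lemma left_invariant_field_linear g : linear (fun u => L u g).
Proof. exact: linearP. Qed.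

Lemma right_invariant_field_linear g : linear (fun u => RI u g).
Proof. exact: linearP. Qed.

Lemma components_left a b q r v : atlas C a -> atlas C b ->
  cdom a (q * r)%g -> cdom b r ->
  'd (fun z => cmap a (q * cinv b z)%g) (cmap b r) (components C b r v) =
  components C a (q * r)%g (tangent_map C C (left_translation q) r v).
Proof.
move=> Ca Cb aqr br.
have [d e] := comp_diff_at wC wC (left_translation_diff_at q r)
  (cmap_diff_at mC Ca aqr).
have [_ e'] := dirderiv_chart mC v Cb br d.
exact: etrans e' (e v).
Qed.

Lemma components_right a b q r v : atlas C a -> atlas C b ->
  cdom a (q * r)%g -> cdom b q ->
  'd (fun z => cmap a (cinv b z * r)%g) (cmap b q) (components C b q v) =
  components C a (q * r)%g (tangent_map C C (right_translation r) q v).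
Proof.
move=> Ca Cb aqr bq.
have [d e] := comp_diff_at wC wC (right_translation_diff_at r q)
  (cmap_diff_at mC Ca aqr).
have [_ e'] := dirderiv_chart mC v Cb bq d.
exact: etrans e' (e v).
Qed.

Definition chart_mul (a b c : chart N 'rV[R]_n) (z : 'rV[R]_n * 'rV[R]_n) :=
  cmap c (cinv a z.1 * cinv b z.2)%g.

Lemma chart_mul_smooth p q : exists2 W, open_nbhs
    (cmap (chart_at C p) p, cmap (chart_at C q) q) W &
  smooth_on W (chart_mul (chart_at C p) (chart_at C q) (chart_at C (p * q)%g)).
Proof. by have [_ [W oW sW]] := lie_group_mul_smooth lieC (p, q); exists W. Qed.

(** In the chart at [p] the field is [x |-> 'd mu (x, e) (0, u)], with [e] the coordinates of the
    unit: a partial derivative of the smooth multiplication, whence the order [k.+1] asked of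
    [mu]. *)
Lemma smooth_left_invariant_field u p : smooth_field_at C (L u) p.
Proof.
set a := chart_at C p; have Ca : atlas C a := at_atlas p.
have ap : cdom a p := domP p.
pose b := chart_at C 1%g; have Cb : atlas C b := at_atlas 1%g.
have b1 : cdom b 1%g := domP 1%g.
have [W [oW Wp] sW] := chart_mul_smooth p 1%g; rewrite mulg1 in sW.
set mu := chart_mul _ _ _ in sW.
pose i (x : 'rV[R]_n) := (x, cmap b 1%g).
have Ci k U : open U -> Ck k U i.
  move=> oU; apply: Ck_pair => //; last exact: Ck_const.
  by apply: Ck_linear => // x; exact: cvg_id.
pose U := (i @^-1` W) `&` (cmap a @` cdom a).
have oU : open U.
  apply: openI; last exact: cimage_open (atlasP Ca).
  apply: open_comp => // x _.
  by have := Ci 0%N setT openT; apply.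
exists U => [|k].
  by split=> //; split=> //; exists p.
have [dmu ddmu] := sW k.+1.
have UW x : U x -> W (i x) by case.
have := Ck_comp (finite_dim_prod fE fE) oU oW UW (Ci k U oU) (ddmu (0, u)).
apply: Ck_ext => // x; rewrite inE => -[Wx [q aq qx]].
have aq1 : cdom a (q * 1)%g by rewrite mulg1.
rewrite -(diff_partial2 u (dmu _ Wx)) -qx (field_in_chartE mC _ Ca aq).
have := components_left u Ca Cb aq1 b1.
rewrite (components_chart_at mC) -/(L u q) mulg1 => <-.
by rewrite /mu /chart_mul /= -/a (cmapK (atlasP Ca) aq).
Qed.

Lemma smooth_right_invariant_field u p : smooth_field_at C (RI u) p.
Proof.
set a := chart_at C p; have Ca : atlas C a := at_atlas p.
have ap : cdom a p := domP p.
pose b := chart_at C 1%g; have Cb : atlas C b := at_atlas 1%g.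
have b1 : cdom b 1%g := domP 1%g.
have [W [oW Wp] sW] := chart_mul_smooth 1%g p; rewrite mul1g in sW.
set mu := chart_mul _ _ _ in sW.
pose i (x : 'rV[R]_n) := (cmap b 1%g, x).
have Ci k U : open U -> Ck k U i.
  move=> oU; apply: Ck_pair => //; first exact: Ck_const.
  by apply: Ck_linear => // x; exact: cvg_id.
pose U := (i @^-1` W) `&` (cmap a @` cdom a).
have oU : open U.
  apply: openI; last exact: cimage_open (atlasP Ca).
  apply: open_comp => // x _.
  by have := Ci 0%N setT openT; apply.
exists U => [|k].
  by split=> //; split=> //; exists p.
have [dmu ddmu] := sW k.+1.
have UW x : U x -> W (i x) by case.
have := Ck_comp (finite_dim_prod fE fE) oU oW UW (Ci k U oU) (ddmu (u, 0)).
apply: Ck_ext => // x; rewrite inE => -[Wx [q aq qx]].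
have a1q : cdom a (1 * q)%g by rewrite mul1g.
rewrite -(diff_partial1 u (dmu _ Wx)) -qx (field_in_chartE mC _ Ca aq).
have := components_right u Ca Cb a1q b1.
rewrite (components_chart_at mC) -/(RI u q) mul1g => <-.
by rewrite /mu /chart_mul /= -/a (cmapK (atlasP Ca) aq).
Qed.

End LieGroups.

(** * Brackets of invariant fields *)

Section Brackets.
Context {R : realType} {n : nat} {N : groupTopologicalType}.
Variable C : charted N 'rV[R]_n.
Hypothesis lieC : is_lie_group C.

Let mC : is_smooth_manifold C := lie_group_manifold lieC.
Let fE : finite_dim 'rV[R]_n := @finite_dim_rV R n.
Let at_atlas p : atlas C (chart_at C p) := chart_at_atlas mC p.
Let domP p : cdom (chart_at C p) p := chart_at_dom mC p.
Let atlasP a : atlas C a -> is_chart a := atlas_chart mC (a := a).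

Local Notation L := (left_invariant_field C).
Local Notation RI := (right_invariant_field C).

Let V := 'rV[R]_n.
Variable p : N.
Let a := chart_at C p.
Let b := chart_at C 1%g.
Let x0 : V * V := (cmap a p, cmap b 1%g).
(** Multiplication near [(p, 1)]. With the chart at the unit on the second factor and the chart at
    [p] on the result, one map compares brackets at the unit with brackets at [p]. *)
Let mu : V * V -> V := chart_mul a b a.

Let mu_smooth : exists2 W, open_nbhs x0 W & smooth_on W mu.
Proof. by have := chart_mul_smooth lieC p 1%g; rewrite mulg1. Qed.

Let mu0 : mu x0 = cmap a p.
Proof.
by rewrite /mu /chart_mul /= !(cmapK (atlasP (at_atlas _)) (domP _)) mulg1.
Qed.

Let near_mu : \forall z \near x0, exists q r,
  [/\ z = (cmap a q, cmap b r), cdom a q, cdom b r, cdom a (q * r)%g &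
      differentiable mu z].
Proof.
have [W [oW Wx] /(_ 1%N) [dmu _]] := mu_smooth.
have Ca := at_atlas p; have Cb := at_atlas 1%g.
have ab0 : cdom (prod_chart a b) (p, 1%g) by split; exact: domP.
have cab := is_chart_prod (atlasP Ca) (atlasP Cb).
have nm : \forall y \near (p, 1%g : N), cdom a (y.1 * y.2)%g.
  have [cm _] := mul_diff_at lieC (p, 1%g).
  by apply: cm; rewrite /= mulg1; exact: (near_cdom mC Ca (domP p)).
have nq := near_cinv cab ab0 nm.
have nW : \forall z \near x0, W z by apply: open_nbhs_nbhs.
apply: filterS3 (near_cinvK cab ab0) nW nq => z [[az bz] zK] Wz aqr.
by exists (cinv a z.1), (cinv b z.2); split=> //; exact: dmu.
Qed.

Let field_left u (z : V * V) := (0 : V, field_in_chart C b (L u) z.2) : V * V.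
Let field_right u (z : V * V) := (field_in_chart C a (RI u) z.1, 0 : V) : V * V.

(** Along the second factor, [mu] is left translation by the first, which carries the value of [L u]
    at [r] to its value at [q * r]. *)
Let left_related u : {near x0,
  (fun z => field_in_chart C a (L u) (mu z)) =1 fun z => 'd mu z (field_left u z)}.
Proof.
apply: filterS near_mu => _ [q [r [-> aq br aqr dmu]]].
have Ca := at_atlas p; have Cb := at_atlas 1%g.
rewrite /mu /chart_mul /= (cmapK (atlasP Ca) aq) (cmapK (atlasP Cb) br).
rewrite -/(chart_mul a b a) -/mu /field_left /=.
rewrite (field_in_chartE mC _ Ca aqr) -(left_invariant_field_push lieC).
apply: etrans (esym (components_left lieC _ Ca Cb aqr br)) _.
rewrite (field_in_chartE mC _ Cb br).
apply: etrans _ (diff_partial2 _ dmu).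
by rewrite /mu /chart_mul /= (cmapK (atlasP Ca) aq).
Qed.

Let right_related u : {near x0,
  (fun z => field_in_chart C a (RI u) (mu z)) =1 fun z => 'd mu z (field_right u z)}.
Proof.
apply: filterS near_mu => _ [q [r [-> aq br aqr dmu]]].
have Ca := at_atlas p; have Cb := at_atlas 1%g.
rewrite /mu /chart_mul /= (cmapK (atlasP Ca) aq) (cmapK (atlasP Cb) br).
rewrite -/(chart_mul a b a) -/mu /field_right /=.
rewrite (field_in_chartE mC _ Ca aqr) -(right_invariant_field_push lieC).
apply: etrans (esym (components_right lieC _ Ca Ca aqr aq)) _.
rewrite (field_in_chartE mC _ Ca aq).
apply: etrans _ (diff_partial1 _ dmu).
by rewrite /mu /chart_mul /= (cmapK (atlasP Cb) br).
Qed.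

Let diff_left u : differentiable (field_left u) x0 /\
  forall v, 'd (field_left u) x0 v =
    (0, 'd (field_in_chart C b (L u)) (cmap b 1%g) v.2).
Proof.
apply: (@differentiable_inr_snd _ V V V (field_in_chart C b (L u)) x0).
exact: smooth_field_differentiable (smooth_left_invariant_field lieC u 1%g).
Qed.

Let diff_right u : differentiable (field_right u) x0 /\
  forall v, 'd (field_right u) x0 v =
    ('d (field_in_chart C a (RI u)) (cmap a p) v.1, 0).
Proof.
apply: (@differentiable_inl_fst _ V V V (field_in_chart C a (RI u)) x0).
exact: smooth_field_differentiable (smooth_right_invariant_field lieC u p).
Qed.

Let diff_in_chart (X : N -> V) : smooth_field_at C X p ->
  differentiable (field_in_chart C a X) (mu x0).
Proof. by move=> sX; rewrite mu0; exact: smooth_field_differentiable sX. Qed.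

(* On the product, [(0, L u)] and [(RI v, 0)] commute, and multiplication maps
   them to [L u] and [RI v]. *)
Lemma lie_bracket_left_right u v : lie_bracket C (L u) (RI v) p = 0.
Proof.
have [W [oW Wx] sW] := mu_smooth.
have [dX eX] := diff_left u; have [dY eY] := diff_right v.
have dX' := diff_in_chart (smooth_left_invariant_field lieC u p).
have dY' := diff_in_chart (smooth_right_invariant_field lieC v p).
have := bracket_related (finite_dim_prod fE fE) fE oW Wx (sW 2%N) dX dY dX' dY'
  (left_related u) (right_related v).
rewrite mu0 !(field_in_chart_at mC) => h; apply: etrans h _.
(* Each field varies only along the factor to which it is tangent, and there the other field has no
   component. *)
have z : 'd (field_right v) x0 (field_left u x0)
    - 'd (field_left u) x0 (field_right v x0) = 0.
  apply: etrans (congr2 (fun x y => x - y) (eY _) (eX _)) _.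
  apply: (congr2 (@pair V V)).
    by apply: etrans (subr0 _) _; exact: linear0.
  apply: etrans (sub0r _) _; apply: etrans (congr1 -%R (linear0 _)) _.
  exact: oppr0.
exact: etrans (congr1 ('d mu x0) z) (linear0 _).
Qed.

(** On the product, the bracket of [(0, L u)] and [(0, L v)] at [(p, 1)] is [(0, br)], with [br] the
    bracket at the unit; multiplication sends it to the left translate of [br] by [p]. *)
Lemma lie_bracket_left u v :
  lie_bracket C (L u) (L v) p = L (lie_algebra_bracket C u v) p.
Proof.
have [W [oW Wx] sW] := mu_smooth.
have [dX eX] := diff_left u; have [dY eY] := diff_left v.
have dX' := diff_in_chart (smooth_left_invariant_field lieC u p).
have dY' := diff_in_chart (smooth_left_invariant_field lieC v p).
have := bracket_related (finite_dim_prod fE fE) fE oW Wx (sW 2%N) dX dY dX' dY'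
  (left_related u) (left_related v).
rewrite mu0 !(field_in_chart_at mC) => h; apply: etrans h _.
have z : 'd (field_left v) x0 (field_left u x0)
    - 'd (field_left u) x0 (field_left v x0) =
    (0, lie_algebra_bracket C u v).
  apply: etrans (congr2 (fun x y => x - y) (eY _) (eX _)) _.
  apply: (congr2 (@pair V V)); first exact: subr0.
  by rewrite /field_left /= !(field_in_chart_at mC).
apply: etrans (congr1 ('d mu x0) z) _.
have [dmu _] := sW 1%N.
apply: etrans (esym (diff_partial2 _ (dmu _ Wx))) _.
have Ca := at_atlas p; have Cb := at_atlas 1%g.
have ap1 : cdom a (p * 1)%g by rewrite mulg1; exact: domP.
have := components_left lieC (lie_algebra_bracket C u v) Ca Cb ap1 (domP 1%g).
rewrite (components_chart_at mC) -/(L _ p) mulg1 (components_chart_at mC) => <-.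
by rewrite /mu /chart_mul /= (cmapK (atlasP Ca) (domP p)).
Qed.

End Brackets.

(** * The Levi-Civita connection of a bi-invariant metric *)

Section BiInvariantMetric.
Context {R : realType} {n : nat} {N : topologicalType}.
Variables (C : charted N 'rV[R]_n) (Q : N -> 'rV[R]_n -> 'rV[R]_n -> R).
Variable nabla : N -> 'rV[R]_n -> (N -> 'rV[R]_n) -> 'rV[R]_n.
Hypothesis mC : is_smooth_manifold C.
Hypothesis pathN : forall x y : N, exists c : R -> N,
  [/\ {within `[0, 1], continuous c}, c 0 = x & c 1 = y].
Hypothesis metricQ : pseudo_riemannian_metric C Q.
Hypothesis LC : levi_civita C Q nabla.

(* [L] and [RI] stand for the left and right invariant fields with value [u]
   at the unit [o], and [br] for the bracket of the Lie algebra. *)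
Variables (L RI : 'rV[R]_n -> N -> 'rV[R]_n) (o : N).
Variable br : 'rV[R]_n -> 'rV[R]_n -> 'rV[R]_n.
Hypothesis sL : forall u p, smooth_field_at C (L u) p.
Hypothesis sRI : forall u p, smooth_field_at C (RI u) p.
Hypothesis L_linear : forall p, linear (L^~ p).
Hypothesis RI_linear : forall p, linear (RI^~ p).
Hypothesis L_surj : forall p v, exists u, L u p = v.
Hypothesis RI_surj : forall p v, exists u, RI u p = v.
Hypothesis L_unit : forall u, L u o = u.
Hypothesis RI_unit : forall u, RI u o = u.
Hypothesis bracket_left_right : forall p u v, lie_bracket C (L u) (RI v) p = 0.
Hypothesis bracket_left : forall p u v,
  lie_bracket C (L u) (L v) p = L (br u v) p.
Hypothesis br_nilpotent : forall u v w, br u (br v w) = 0.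
Hypothesis metric_left : forall u v p, Q p (L u p) (L v p) = Q o u v.
Hypothesis metric_right : forall u v p, Q p (RI u p) (RI v p) = Q o u v.

Let aff : affine_connection C nabla := levi_civita_connection LC.

Lemma metric_left_nondegenerate p z : (forall b, Q p z (L b p) = 0) -> z = 0.
Proof.
move=> h; apply: (metric_nondegenerate metricQ (p := p)) => v.
by have [u <-] := L_surj p v.
Qed.

Lemma dirderiv_const (k : R) p v : dirderiv C (fun=> k) p v = 0.
Proof. exact: (const_diff_at C (model R) k p).2. Qed.

Lemma nabla_left_right p u v : nabla p (L u p) (RI v) = nabla p (RI v p) (L u).
Proof.
apply/eqP; rewrite -subr_eq0; apply/eqP.
rewrite (levi_civita_torsion_free LC (sL u p) (sRI v p)).
exact: bracket_left_right.
Qed.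

Let T p a b c := Q p (nabla p (L a p) (L b)) (L c p).

(* Since [RI u] commutes with [L a], the constancy of [Q (RI u) (RI v)] along
   [L a] makes [L a] a Killing field. *)
Lemma nabla_left_skew p a x y :
  Q p (nabla p x (L a)) y + Q p x (nabla p y (L a)) = 0.
Proof.
have [u <-] := RI_surj p x.
have [v <-] := RI_surj p y.
rewrite -!nabla_left_right.
rewrite -(levi_civita_metric LC (L a p) (sRI u p) (sRI v p)).
rewrite (_ : (fun q => _) = (fun=> Q o u v)) ?dirderiv_const//.
by apply/funext => q; rewrite metric_right.
Qed.

Lemma nabla_left_skew13 p a b c : T p a b c = - T p c b a.
Proof.
apply/eqP; rewrite -addr_eq0 /T [X in _ + X](Defs.metric_sym metricQ).
by rewrite nabla_left_skew.
Qed.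

Lemma nabla_left_skew23 p a b c : T p a b c = - T p a c b.
Proof.
apply/eqP; rewrite -addr_eq0 /T [X in _ + X](Defs.metric_sym metricQ).
rewrite -(levi_civita_metric LC (L a p) (sL b p) (sL c p)).
rewrite (_ : (fun q => _) = (fun=> Q o b c)) ?dirderiv_const//.
by apply/funext => q; rewrite metric_left.
Qed.

(** A rotation is a product of two transpositions, whose signs cancel. *)
Lemma nabla_left_rot p a b c : T p a b c = T p b c a.
Proof.
have rot x y z : T p x y z = T p z x y by rewrite [LHS]nabla_left_skew13 nabla_left_skew23 opprK.
by rewrite [LHS]rot [LHS]rot.
Qed.

(** By torsion freeness the bracket paired with [L c] is [T p a b c - T p b a c], and the symmetries
    of [T] make this [2 * T p a b c]. *)
Lemma nabla_left p a b : 2 *: nabla p (L a p) (L b) = L (br a b) p.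
Proof.
rewrite -(bracket_left) -(levi_civita_torsion_free LC (sL a p) (sL b p)).
apply/eqP; rewrite -subr_eq0; apply/eqP.
apply: (@metric_left_nondegenerate p) => c.
rewrite (metric_Bl metricQ) (metric_Zl metricQ) (metric_Bl metricQ).
rewrite -/(T p a b c) -/(T p b a c)
  (nabla_left_skew13 p b) (nabla_left_rot p c) opprK.
by rewrite mulr_natl mulr2n subrr.
Qed.

(* Write [RI u p] as [L w p] and use the invariance of [T] under rotation. *)
Lemma nabla_right_metric p a u b :
  Q p (nabla p (L a p) (RI u)) (L b p) = Q p (RI u p) (nabla p (L a p) (L b)).
Proof.
rewrite nabla_left_right; have [w <-] := L_surj p (RI u p).
by rewrite [RHS](Defs.metric_sym metricQ) -/(T p w a b) -/(T p a b w) nabla_left_rot.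
Qed.

Lemma left_field0 p : L 0 p = 0.
Proof.
have := L_linear p 1 0 0; rewrite !scale1r !addr0 => e.
by apply: (addrI (L 0 p)); rewrite -e addr0.
Qed.

Lemma dirderiv_right_left p a u c :
  dirderiv C (fun q => Q q (RI u q) (L c q)) p (L a p) =
  Q p (RI u p) (L (br a c) p).
Proof.
rewrite (levi_civita_metric LC (L a p) (sRI u p) (sL c p)) nabla_right_metric.
by rewrite -(metric_Dr metricQ) -nabla_left scaler_nat mulr2n.
Qed.

Lemma metric_right_bracket p u b d :
  Q p (RI u p) (L (br b d) p) = Q o u (br b d).
Proof.
have d0 q v : dirderiv C (fun q => Q q (RI u q) (L (br b d) q)) q v = 0.
  have [a <-] := L_surj q v.
  by rewrite dirderiv_right_left br_nilpotent left_field0 (metric_0r metricQ).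
have dq q : diff_at C (model R) (fun q => Q q (RI u q) (L (br b d) q)) q.
  exact: (metric_diff_at metricQ (sRI u q) (sL _ q)).
have := path_connected_const pathN (fun q => diff0_const mC q dq d0).
move=> /(_ p o) ->.
by rewrite L_unit RI_unit.
Qed.

(** Paired with [L b], twice the derivative of [RI u] along [L a] is [Q p (RI u p) (L (br a b) p)].
    As [br a b] is a bracket, [RI u] may be replaced here by [L u]: both pairings equal
    [Q o u (br a b)]. The result is [2 * T p a b u], that is [- 2 * T p a u b], which cancels the
    contribution of [L u]. *)
Lemma parallel_left_right u : parallel_field C nabla (fun q => L u q + RI u q).
Proof.
split=> [p|p v]; first exact: (smooth_field_add (sL u p) (sRI u p)).
rewrite (connection_add aff v (sL u p) (sRI u p)).
have [a <-] := L_surj p v.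
apply: (@metric_left_nondegenerate p) => b.
rewrite (metric_Dl metricQ) nabla_right_metric.
suff : 2 * (T p a u b + Q p (RI u p) (nabla p (L a p) (L b))) = 0.
  by move/eqP; rewrite mulf_eq0 pnatr_eq0 /= => /eqP.
rewrite mulrDr -(metric_Zr metricQ p (RI u p)) nabla_left metric_right_bracket.
rewrite -(metric_left _ _ p) -nabla_left (metric_Zr metricQ) -mulrDr.
rewrite [X in _ + X](Defs.metric_sym metricQ) -/(T p a b u) nabla_left_skew23.
by rewrite addNr mulr0.
Qed.

Lemma metric_left_right u v p :
  Q p (L u p + RI u p) (L v p + RI v p) = 2 * 2 * Q o u v.
Proof.
have [su pu] := parallel_left_right u; have [sv pv] := parallel_left_right v.
pose f q := Q q (L u q + RI u q) (L v q + RI v q).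
have df q : diff_at C (model R) f q := metric_diff_at metricQ (su q) (sv q).
have f0 q w : dirderiv C f q w = 0.
  rewrite /f (levi_civita_metric LC w (su q) (sv q)) pu pv.
  by rewrite (metric_0l metricQ) (metric_0r metricQ) addr0.
rewrite -/(f p) (path_connected_const pathN (fun q => diff0_const mC q df f0) p o).
rewrite /f !L_unit !RI_unit.
by rewrite !(metric_Dl metricQ) !(metric_Dr metricQ); ring.
Qed.

(** The map [u |-> L u p + RI u p] is injective, by [metric_left_right] and nondegeneracy at [o]. It
    is given by a square matrix, hence onto, and [z] is orthogonal to every vector. *)
Lemma left_right_spanning p z :
  (forall u, Q p z (L u p + RI u p) = 0) -> z = 0.
Proof.
move=> h; pose W u := L u p + RI u p.
have lW : linear W.
  move=> k x y; rewrite /W L_linear RI_linear.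
  by rewrite scalerDr addrACA.
pose l : {linear 'rV[R]_n -> 'rV[R]_n} :=
  HB.pack W (GRing.isLinear.Build _ _ _ _ W lW).
have lE (u : 'rV[R]_n) : u *m lin1_mx l = W u := mul_rV_lin1 l u.
have injW (u : 'rV[R]_n) : u *m lin1_mx l = 0 -> u = 0.
  rewrite lE => Wu0; apply: (metric_nondegenerate metricQ (p := o)) => v.
  have := metric_left_right u v p; rewrite -/(W u) Wu0 (metric_0l metricQ).
  by move/esym/eqP; rewrite !mulf_eq0 pnatr_eq0 /= => /eqP.
have full : row_full (lin1_mx l).
  rewrite row_full_unit -row_free_unit -kermx_eq0; apply/rowV0P => u.
  by move/sub_kermxP; exact: injW.
apply: (metric_nondegenerate metricQ (p := p)) => v.
have /submxP [u ->] := submx_full v full.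
by rewrite lE; exact: h.
Qed.

End BiInvariantMetric.

Theorem proposition5p3 (R : realType) (n : nat) (N : groupTopologicalType)
    (C : charted N 'rV[R]_n) (Q : N -> 'rV[R]_n -> 'rV[R]_n -> R) :
  is_lie_group C ->
  simply_connected R N ->
  two_step_nilpotent C ->
  pseudo_riemannian_metric C Q ->
  bi_invariant C Q ->
  flat C Q /\ trivial_holonomy C Q.
Proof.
move=> lieC [pathN _] [nilC _] metricQ biQ.
have mC := lie_group_manifold lieC; have fE := @finite_dim_rV R n.
(* Bi-invariance is applied at the unit, from which invariant fields are translated by
   definition. *)
have metric_left u v p : Q p (left_invariant_field C u p)
    (left_invariant_field C v p) = Q 1%g u v.
  by have [+ _] := biQ p 1%g u v; rewrite {1}/left_translation mulg1.
have metric_right u v p : Q p (right_invariant_field C u p)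
    (right_invariant_field C v p) = Q 1%g u v.
  by have [_] := biQ p 1%g u v; rewrite {1}/right_translation mul1g.
have parallel nabla (LC : levi_civita C Q nabla) :=
  parallel_left_right mC pathN metricQ LC
    (smooth_left_invariant_field lieC) (smooth_right_invariant_field lieC)
    (left_invariant_field_linear C)
    (left_invariant_field_surj lieC) (right_invariant_field_surj lieC)
    (left_invariant_field1 lieC) (right_invariant_field1 lieC)
    (lie_bracket_left_right lieC) (lie_bracket_left lieC) nilC
    metric_left metric_right.
have spanning nabla (LC : levi_civita C Q nabla) :=
  left_right_spanning mC pathN metricQ LC
    (smooth_left_invariant_field lieC) (smooth_right_invariant_field lieC)
    (left_invariant_field_linear C) (right_invariant_field_linear C)
    (left_invariant_field_surj lieC) (right_invariant_field_surj lieC)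
    (left_invariant_field1 lieC) (right_invariant_field1 lieC)
    (lie_bracket_left_right lieC) (lie_bracket_left lieC) nilC
    metric_left metric_right.
split=> nabla LC.
  move=> X Y Z p.
  exact: (curvature0 mC fE metricQ LC (parallel _ LC) (spanning _ LC)).
move=> p.
exact: (holonomy_trivial mC fE metricQ LC (parallel _ LC) (spanning _ LC)).
Qed.
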